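(* Let $\mathcal{H}$ be a real Hilbert space and let $f:\mathcal{H}\to\mathbb{R}\cup\{+\infty\}$ be proper, convex, lower semicontinuous with $\operatorname{argmin} f\neq\emptyset$. Let $\alpha,c>0$, $0<q\le 1$, $q+1\le p$, $\lambda>0$, $\delta\ge 0$, and for $k\ge1$ put $\alpha_k=1-\frac{\alpha}{k^q}$, $c_k=\frac{c}{k^p}$, $\lambda_k=\lambda k^\delta$. Let $x_0,x_1\in\mathcal H$ and let $(x_k)$ be generated by $$x_{k+1}=\operatorname{prox}_{\lambda_k f}\big(x_k+\alpha_k(x_k-x_{k-1})-c_kx_k\big),\quad k\ge1.$$ For every $k\ge 2$ let $u_k\in\partial f(x_k)$ be the element satisfying $$x_k=\alpha_{k-1}(x_{k-1}-x_{k-2})-\lambda_{k-1}u_k+(1-c_{k-1})x_{k-1}.$$ Then the following hold. (i) If either [$\alpha>0$, $\delta\ge 0$, $0<q<1$, $q+1<p\le 2$, and for $p=2$ one has $c>q(1-q)$], or [$\alpha>3$, $0\le\delta<\alpha-3$, $q=1$ and $p>2$], then $$f(x_k)-\min_{\mathcal H} f=\mathcal{O}(k^{-q-\delta-1}),\quad \|x_k-x_{k-1}\|=\mathcal{O}(k^{-\frac{q+1}{2}}),\quad \|u_k\|=o(k^{-\frac{q+1}{2}-\delta})\quad\text{as }k\to+\infty.$$ Further, $$\sum_{k=1}^{+\infty}k^{q+\delta}(f(x_k)-\min_{\mathcal H} f)<+\infty,\quad \sum_{k=1}^{+\infty}k\|x_k-x_{k-1}\|^2<+\infty,\quad \sum_{k=2}^{+\infty}k^{q+2\delta+1}\|u_k\|^2<+\infty.$$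 (ii) If either [$\alpha>0$, $\delta\ge0$, $0<q<1$ and $q+1\le p$], or [$\alpha>3$, $0\le\delta<\alpha-3$, $q=1$ and $p\ge 2$], then for all $s\in\left]\frac12,\frac{q+1}{2}\right[$ one has $$f(x_k)-\min_{\mathcal H} f=o(k^{-2s-\delta}),\quad \|x_k-x_{k-1}\|=o(k^{-s}),\quad \|u_k\|=o(k^{-s-\delta})\quad\text{as }k\to+\infty.$$ Further, $$\sum_{k=1}^{+\infty}k^{2s+\delta-1}(f(x_k)-\min_{\mathcal H} f)<+\infty,\quad \sum_{k=1}^{+\infty}k^{2s-q}\|x_k-x_{k-1}\|^2<+\infty,\quad \sum_{k=2}^{+\infty}k^{2s+2\delta}\|u_k\|^2<+\infty.$$
   Context: For $s>0$, $\operatorname{prox}_{sf}(x)=\operatorname{argmin}_{y\in\mathcal H}\left(f(y)+\frac{1}{2s}\|y-x\|^2\right)$. $\partial f$ is the convex subdifferential; since $\operatorname{prox}_{sf}=(I+s\,\partial f)^{-1}$, the vector $u_k$ defined by the stated equality indeed belongs to $\partial f(x_k)$.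
   Formalization: The two series in f(x_k) − min f are shown finite from k = 2 always, and from k = 1 only when f(x_1) < +∞, since x_1 is arbitrary and the k = 1 term is infinite if f(x_1) = +∞. *)

(* Defs.v *)
From HB Require Import structures.
From mathcomp Require Import all_boot all_order all_algebra.
From mathcomp Require Import all_classical all_reals all_analysis.

Set Implicit Arguments.
Unset Strict Implicit.
Unset Printing Implicit Defensive.

Import Order.TTheory GRing.Theory Num.Theory.
Import numFieldNormedType.Exports.

Local Open Scope classical_set_scope.
Local Open Scope ring_scope.

(* A real Hilbert space is a complete normed module [H] over a [realType]
   together with a positive definite symmetric bilinear form
   [dot : {dot H for idfun}] that induces the norm. *)
Definition induces_norm (R : realType) (H : completeNormedModType R)
    (dot : {dot H for idfun}) : Prop :=
  forall x : H, `|x| ^+ 2 = dot x x.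

Section ConvexAnalysis.
Context {R : realType}.

Section Functions.
Context {H : completeNormedModType R}.
Implicit Types (f : H -> \bar R) (x y u : H).

Definition proper_efun f : Prop :=
  (forall x, f x != -oo%E) /\ (exists x, f x != +oo%E).

(* The endpoints t = 0, 1 are harmless: 0 * +oo = 0 in \bar R. *)
Definition convex_efun f : Prop :=
  forall x y (t : R), 0 <= t <= 1 ->
    (f (t *: x + (1 - t) *: y)%R
       <= t%:E * f x + (1 - t)%R%:E * f y)%E.

Definition argmin f : set H := [set x | forall y, (f x <= f y)%E].

(* The infimum, which is the minimum whenever [argmin f !=set0]. *)
Definition minval f : \bar R := ereal_inf (range f).

(* When [f] is proper, convex and lower semicontinuous and [0 < s], the
   argmin is a singleton; [xget] returns its element. *)
Definition prox (s : R) f x : H :=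
  xget 0 (argmin (fun y => f y + ((2 * s)^-1 * `|y - x| ^+ 2)%:E)%E).

Definition subdifferential (dot : {dot H for idfun}) f x : set H :=
  [set u | f x \is a fin_num /\
           forall y, (f x + (dot u (y - x))%:E <= f y)%E].

End Functions.

Definition alpha_ (alpha q : R) (k : nat) : R := 1 - alpha / k%:R `^ q.
Definition c_ (c p : R) (k : nat) : R := c / k%:R `^ p.
Definition lambda_ (lambda delta : R) (k : nat) : R := lambda * k%:R `^ delta.

End ConvexAnalysis.

(* Main.v *)
(* Write s = (q + 1) / 2, D_k = x_k - z with z a minimizer, V_k = x_k - x_{k-1},
   g_k = f(x_k) - min f, and put
     W_k = a k^(s-1) D_k + k^s (1 - alpha / k^q) V_k,
     E_k = m_k g_k + |W_k|^2 + n |D_k|^2 + c k^(q+1-p) |x_k|^2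
   with m_k of order k^(q+1+delta).  By the recursion, W_{k+1} - W_k is a combination
   of D_{k+1}, V_{k+1}, lambda_k u_{k+1} and c_k x_k, so expanding
   |W_{k+1}|^2 = |W_k|^2 + 2 <W_{k+1} - W_k, W_{k+1}> - |W_{k+1} - W_k|^2 and using the
   subgradient inequalities for u_{k+1} at z and at x_k gives
     E_{k+1} + (k^(q+delta) g_{k+1} + k |V_{k+1}|^2 + k^(q+1+2 delta) |u_{k+1}|^2) / C
       <= (1 + C k^(-1-rho)) E_k + C (k^(q-p) + k^(-1-rho)).
   This needs a > q + 1 + delta, and a < alpha - 1 when q = 1.  The weights only have to
   be right to leading order: the remainders are absorbed by k |V_{k+1}|^2 and by n |D_k|^2.
   If p > q + 1 the right-hand side is summable and Gronwall's argument yields (i).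
   Otherwise the inequality is first multiplied by k^(-theta), theta > 0; taking
   theta = q + 1 - 2 s' gives the series of (ii) for the exponent s', and half that theta
   turns the resulting O-bounds into the o-bounds. *)
Require Import Defs.
From HB Require Import structures.
From mathcomp Require Import all_boot all_order all_algebra.
From mathcomp Require Import all_classical all_reals all_analysis.
From mathcomp Require Import ring lra.

Import Order.TTheory GRing.Theory Num.Theory.
Import numFieldNormedType.Exports.

Local Open Scope classical_set_scope.
Local Open Scope ring_scope.

Set Implicit Arguments.
Unset Strict Implicit.
Unset Printing Implicit Defensive.

(** * Proximal points in a Hilbert space *)

Section InnerProduct.
Context {R : realType} {H : completeNormedModType R}.
Variable dot : {dot H for idfun}.
Hypothesis Hdot : induces_norm dot.
Implicit Types x y z : H.

Lemma dotC x y : dot x y = dot y x.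
Proof. by rewrite hermC /= expr0 mul1r. Qed.

Lemma dotDl x y z : dot (x + y) z = dot x z + dot y z.
Proof. exact: linearDl. Qed.

Lemma dotNl x z : dot (- x) z = - dot x z.
Proof. exact: linearNl. Qed.

Lemma dotZl a x z : dot (a *: x) z = a * dot x z.
Proof. exact: linearZl_LR. Qed.

Lemma dotDr x y z : dot z (x + y) = dot z x + dot z y.
Proof. exact: linearDr. Qed.

Lemma dotNr x z : dot z (- x) = - dot z x.
Proof. exact: linearNr. Qed.

Lemma dotZr a x z : dot z (a *: x) = a * dot z x.
Proof. by rewrite dotC dotZl dotC. Qed.

Definition dotE := (dotDl, dotDr, dotNl, dotNr, dotZl, dotZr).

Lemma dot_ge0 x : 0 <= dot x x.
Proof. by rewrite -Hdot exprn_ge0. Qed.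

(** Expand [|e x - w y|^2 >= 0] and divide by [w]. Later [w] is [kap * t], so a cross term with
    coefficient [e] costs part of the velocity dissipation plus a term of size
    [e ^+ 2 / (kap * t)]. *)
Lemma young_dot (w e : R) x y : 0 < w ->
  2 * e * dot x y <= e ^+ 2 / w * dot x x + w * dot y y.
Proof.
move=> w0; have := dot_ge0 (e *: x - w *: y); rewrite !dotE (dotC y x) => h.
have -> : e ^+ 2 / w * dot x x + w * dot y y
  = (e ^+ 2 * dot x x + w ^+ 2 * dot y y) / w by field; rewrite gt_eqF.
by rewrite ler_pdivlMr//; nra.
Qed.

Section Prox.
Variables (f : H -> \bar R).
Hypothesis f_proper : proper_efun f.
Hypothesis f_convex : convex_efun f.
Hypothesis f_lsc : lower_semicontinuous f.
Hypothesis f_argmin : argmin f !=set0.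

Lemma minval_argmin z : argmin f z -> minval f = f z.
Proof.
move=> zm; apply/eqP; rewrite eq_le; apply/andP; split.
  by apply: ereal_inf_lbound; exists z.
by apply: le_ereal_inf_tmp => _ [y _ <-]; exact: zm.
Qed.

Lemma argmin_fin_num z : argmin f z -> f z \is a fin_num.
Proof.
move=> zm; have [fN [y fy]] := f_proper; rewrite fin_numE fN /=.
by apply: contra fy => /eqP fz; have := zm y; rewrite fz leye_eq.
Qed.

Lemma minval_fin_num : minval f \is a fin_num.
Proof.
have [z zm] := f_argmin.
by rewrite (minval_argmin zm) argmin_fin_num.
Qed.

Lemma minval_le y : (minval f <= f y)%E.
Proof. by apply: ereal_inf_lbound; exists y. Qed.

Let phi (r : R) (x y : H) : \bar R := (f y + (r * `|y - x| ^+ 2)%:E)%E.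

(* Midpoint strong convexity: the parallelogram identity makes near minimizers
   of [phi] close to each other. *)
Lemma prox_objective_midpoint (r : R) x y z (I e : R) : 0 < r ->
  (forall w, I%:E <= phi r x w)%E ->
  (phi r x y <= (I + e)%:E)%E -> (phi r x z <= (I + e)%:E)%E ->
  r * `|y - z| ^+ 2 <= 4 * e.
Proof.
move=> r0 Ilb; rewrite /phi => hy hz.
have [fN _] := f_proper.
have fin w : (phi r x w <= (I + e)%:E)%E -> f w \is a fin_num.
  rewrite /phi => hw; rewrite fin_numE fN /=; apply/eqP => fw.
  by move: hw; rewrite fw.
have := Ilb (2^-1 *: y + (1 - 2^-1) *: z).
have /f_convex-/(_ y z) : 0 <= (2^-1 : R) <= 1 by lra.
have fy := fin _ hy; have fz := fin _ hz; have := Ilb (2^-1 *: y + (1 - 2^-1) *: z).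
have /f_convex-/(_ y z) : 0 <= (2^-1 : R) <= 1 by lra.
move: hy hz; rewrite /phi.
rewrite -(fineK fy) -(fineK fz).
case: (f (2^-1 *: y + _)) (fN (2^-1 *: y + (1 - 2^-1) *: z)) => [m||//] _;
  last by rewrite -!EFinM -EFinD.
rewrite -!EFinM -!EFinD !lee_fin !Hdot.
set a := fine (f y); set b := fine (f z).
rewrite !dotE ![dot z y]dotC ![dot x y]dotC ![dot x z]dotC.
move=> h1 h2 h3 h4; nra.
Qed.

(** A minimizing sequence with gaps [1 / (n + 1)] is Cauchy by the midpoint estimate; completeness
    gives a limit, and lower semicontinuity shows that the limit attains the infimum. *)
Lemma prox_objective_min (r : R) x : 0 < r -> exists y, argmin (phi r x) y.
Proof.
move=> r0; have [fN _] := f_proper; have [z zm] := f_argmin.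
have zf := argmin_fin_num zm.
pose I := ereal_inf (range (phi r x)).
have Ilb w : (I <= phi r x w)%E by apply: ereal_inf_lbound; exists w.
have If : I \is a fin_num.
  rewrite fin_numElt; apply/andP; split.
    apply: (@lt_le_trans _ _ (f z)); first by rewrite ltNye; case/fin_numP: zf.
    apply: le_ereal_inf_tmp => _ [w _ <-]; rewrite /phi.
    by rewrite -[leLHS]adde0; apply: leeD; [exact: zm | rewrite lee_fin mulr_ge0 ?exprn_ge0// ltW].
  apply: (le_lt_trans (Ilb z)); rewrite /phi -(fineK zf) -EFinD; exact: ltry.
have exseq n : exists y, (phi r x y <= (fine I + n.+1%:R^-1)%:E)%E.
  have : (I < (fine I + n.+1%:R^-1)%:E)%E.
    by rewrite -{1}(fineK If) lte_fin ltrDl invr_gt0 ltr0n.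
  by move=> /ereal_inf_lt[_ [y _ <-] /ltW hy]; exists y.
pose Y n := projT1 (cid (exseq n)).
have YP n : (phi r x (Y n) <= (fine I + n.+1%:R^-1)%:E)%E := projT2 (cid (exseq n)).
have Yclose n m : (n <= m)%N -> r * `|Y n - Y m| ^+ 2 <= 4 * n.+1%:R^-1.
  move=> nm; apply: (@prox_objective_midpoint r x _ _ (fine I)) => //.
    by move=> w; rewrite fineK.
  apply: (le_trans (YP m)); rewrite lee_fin lerD2l.
  by rewrite lef_pV2 ?posrE ?ltr0n// ler_nat.
have Ycvg : cvgn Y.
  apply: cauchy_cvg; apply/cauchy_exP => e e0 /=.
  have d0 : 0 < r * e ^+ 2 / 4 by rewrite divr_gt0 ?mulr_gt0 ?exprn_gt0.
  have [N _ hN] : \forall n \near \oo, (n.+1%:R^-1 : R) < r * e ^+ 2 / 4.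
    have /cvgrPdist_lt/(_ _ d0) := @cvg_harmonic R.
    apply: filterS => n /=; rewrite sub0r normrN ger0_norm// invr_ge0 ler0n.
  exists (Y N); near=> n; rewrite /= -ball_normE /=.
  have := Yclose N n; have -> : (N <= n)%N by near: n; exact: nbhs_infty_ge.
  move=> /(_ isT) h; have := hN N (leqnn N) => /= h2.
  have : r * `|Y N - Y n| ^+ 2 < r * e ^+ 2.
    by apply: (le_lt_trans h); rewrite mulrC -ltr_pdivlMr.
  rewrite ltr_pM2l// ltr_pXn2r ?nnegrE//; exact: ltW.
pose y := limn Y; exists y => w; apply: (le_trans _ (Ilb w)).
rewrite leNgt; apply/negP => hI.
(* If [phi r x y] exceeded the infimum, some real level [a] strictly below [f y] would still leave
   an excess [e]. A finite [f y] gives up a third of the excess on each side; [f y = +oo] leaves [a]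
   free. *)
have : (exists a e : R, [/\ 0 < e, (a%:E < f y)%E & a + r * `|y - x| ^+ 2 > fine I + e])%R.
  move: hI; rewrite -(fineK If) /phi; case: (f y) (fN y) => [b||//] _.
    rewrite -EFinD lte_fin => h.
    exists (b - (b + r * `|y - x| ^+ 2 - fine I) / 3), ((b + r * `|y - x| ^+ 2 - fine I) / 3).
    by rewrite lte_fin; split; lra.
  move=> _; exists (fine I - r * `|y - x| ^+ 2 + 2), 1; split => //; first exact: ltry.
  by lra.
move=> [a [e [e0 fa ha]]].
have [V Vy hV] := f_lsc fa.
have Yy : Y @ \oo --> y by exact: Ycvg.
have YV : \forall n \near \oo, V (Y n) by exact: Yy.
have Nc : r * `|Y n - x| ^+ 2 @[n --> \oo] --> r * `|y - x| ^+ 2.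
  apply: cvgMr; apply: (@continuous_cvg _ _ _ _ _ _ (fun t : R => t ^+ 2)).
    exact: exprn_continuous.
  by apply: cvg_norm; apply: cvgB => //; exact: cvg_cst.
have e20 : 0 < e / 2 by rewrite divr_gt0.
have hN : \forall n \near \oo, r * `|y - x| ^+ 2 - e / 2 < r * `|Y n - x| ^+ 2.
  by apply: (cvgr_gt _ Nc); rewrite ltrBlDr ltrDl.
have hh : \forall n \near \oo, (n.+1%:R^-1 : R) < e / 2.
  have /cvgrPdist_lt/(_ _ e20) := @cvg_harmonic R.
  apply: filterS => n /=; rewrite sub0r normrN ger0_norm// invr_ge0 ler0n.
near \oo => n.
have h1 : V (Y n) by near: n.
have h2 : r * `|y - x| ^+ 2 - e / 2 < r * `|Y n - x| ^+ 2 by near: n.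
have h3 : (n.+1%:R^-1 : R) < e / 2 by near: n.
have := YP n; rewrite /phi; have := hV _ h1.
case: (f (Y n)) => [b||//]; last by rewrite addye.
rewrite -EFinD lee_fin lte_fin => h4 h5.
have aux (F A B E t c d : R) : F + E < A + c -> c - E / 2 < d -> t < E / 2 ->
  A < B -> B + d <= F + t -> False by lra.
exact: (aux _ _ _ _ _ _ _ ha h2 h3 h4 h5).
Unshelve. all: by end_near.
Qed.

(** First-order optimality: compare [y] with [t *: w + (1 - t) *: y], use convexity, divide by [t]
    and let [t] tend to 0. *)
Lemma prox_objective_subgradient (r : R) x y : 0 < r -> argmin (phi r x) y ->
  subdifferential dot f y ((2 * r) *: (x - y)).
Proof.
move=> r0 ym; have [fN [w0 fw0]] := f_proper.
have fy : f y \is a fin_num.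
  rewrite fin_numE fN /=; apply/eqP => fy.
  have := ym w0; rewrite /phi fy addye// leye_eq.
  by move: fw0 (fN w0); case: (f w0).
split => // w.
case fw : (f w) (fN w) => [c||//] _; last by rewrite leey.
rewrite -(fineK fy) -EFinD lee_fin.
set a := fine (f y).
have key (t : R) : 0 < t <= 1 ->
    a + dot ((2 * r) *: (x - y)) (w - y) <= c + r * t * dot (w - y) (w - y).
  move=> /andP[t0 t1].
  have /f_convex-/(_ w y) : 0 <= t <= 1 by rewrite ltW.
  have := ym (t *: w + (1 - t) *: y); rewrite /phi fw -(fineK fy) -/a.
  case: (f (t *: w + _)) (fN (t *: w + (1 - t) *: y)) => [m||//] _;
    last by rewrite -!EFinM -EFinD.
  rewrite -!EFinM -!EFinD !lee_fin !Hdot => h1 h2.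
  rewrite -(ler_pM2l t0).
  move: h1.
  have -> : t *: w + (1 - t) *: y - x = (y - x) + t *: (w - y).
    by rewrite scalerBl scale1r scalerBr addrCA addrAC.
  rewrite -(opprB y x); move: (w - y) (y - x) => d e.
  by rewrite !dotE (dotC d e) => h1; nra.
set K := r * dot (w - y) (w - y).
have K0 : 0 <= K by rewrite mulr_ge0 ?dot_ge0// ltW.
apply/ler_addgt0Pr => e e0.
(* This [t] makes the remainder [t * K] at most [e]; the summand [e] in the denominator covers
   [K = 0] and keeps [t <= 1]. *)
have t0 : 0 < e / (K + e) <= 1.
  by rewrite divr_gt0 ?ltr_wpDl//= ler_pdivrMr ?mul1r ?lerDr// ltr_wpDl.
apply: (le_trans (key _ t0)); rewrite lerD2l.
have -> : r * (e / (K + e)) * dot (w - y) (w - y) = e * (K / (K + e)).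
  by rewrite /K; ring.
by rewrite ler_piMr ?ler_pdivrMr ?mul1r ?lerDl 1?ltW// ltr_wpDl.
Qed.

Lemma prox_subgradient (s : R) x : 0 < s ->
  subdifferential dot f (prox s f x) (s^-1 *: (x - prox s f x)).
Proof.
move=> s0; have r0 : 0 < (2 * s)^-1 by rewrite invr_gt0 mulr_gt0.
(* The existence of a minimizer rules out the default value 0 of [xget] in [prox]. *)
have /(prox_objective_subgradient r0) : argmin (phi (2 * s)^-1 x) (prox s f x).
  by rewrite /prox; case: xgetP => // no; have [w hw] := prox_objective_min x r0; case: (no w).
suff -> : 2 * (2 * s)^-1 = s^-1 by [].
by field; rewrite gt_eqF.
Qed.

End Prox.
End InnerProduct.

(** * Real powers *)

Section Powers.
Context {R : realType}.
Implicit Types (t e : R).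

Lemma powR_add t x y : 0 < t -> t `^ (x + y) = t `^ x * t `^ y.
Proof. by move=> t0; rewrite powRD// (gt_eqF t0) implybT. Qed.

Lemma powR_le1 t e : 1 <= t -> e <= 0 -> t `^ e <= 1.
Proof. by move=> t1 e0; rewrite -[leRHS](powRr0 t) ler_powR. Qed.

Lemma powR_succ t e : 0 < t -> (t + 1) `^ e = t `^ e * (1 + t^-1) `^ e.
Proof.
move=> t0; rewrite -powRM ?addr_ge0 ?invr_ge0 ?ltW//.
by rewrite mulrDr mulr1 divff ?gt_eqF.
Qed.

Lemma powR_succ_ge t e : 0 < t -> 0 <= e -> t `^ e <= (t + 1) `^ e.
Proof. by move=> t0 e0; rewrite ge0_ler_powR ?nnegrE ?lerDl ?addr_ge0// ltW. Qed.

Lemma powR_succ_le t e : 0 < t -> e <= 0 -> (t + 1) `^ e <= t `^ e.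
Proof.
move=> t0 e0; rewrite -(opprK e) !(powRN _ (- e)) lef_pV2 ?posrE ?powR_gt0 ?addr_gt0//.
by rewrite powR_succ_ge ?oppr_ge0.
Qed.

(** As [1 + t^-1 >= 1], its power with exponent [e <= 1] is at most itself. *)
Lemma powR_succ_le1 t e : 0 < t -> e <= 1 -> (t + 1) `^ e <= t `^ e + t `^ (e - 1).
Proof.
move=> t0 e1; rewrite powR_succ// powR_add// powR_inv1 ?(ltW t0)//.
have -> : t `^ e + t `^ e * t^-1 = t `^ e * (1 + t^-1) by ring.
rewrite ler_pM2l ?powR_gt0//.
by rewrite ler1_powR// lerDl invr_ge0 ltW.
Qed.

(** Here [(1 + t^-1) ^ e >= (1 + t^-1)^-1 >= 1 - t^-1]. *)
Lemma powR_succ_geN1 t e : 0 < t -> -1 <= e -> t `^ e - t `^ (e - 1) <= (t + 1) `^ e.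
Proof.
move=> t0 e1; rewrite powR_succ// powR_add// powR_inv1 ?(ltW t0)//.
have -> : t `^ e - t `^ e * t^-1 = t `^ e * (1 - t^-1) by ring.
rewrite ler_pM2l ?powR_gt0//.
have u1 : 1 <= 1 + t^-1 by rewrite lerDl invr_ge0 ltW.
apply: (le_trans _ (ler_powR u1 e1)).
rewrite powR_inv1; last by rewrite (le_trans _ u1).
have i0 : 0 < t^-1 by rewrite invr_gt0.
by rewrite -[leRHS]mul1r ler_pdivlMr ?(lt_le_trans _ u1)//; nra.
Qed.

(* From [expR (- z) >= 1 - z]. *)
Lemma powR_1D_le (y e : R) : 0 <= y -> 0 <= e -> e * y < 1 ->
  (1 + y) `^ e <= (1 - e * y)^-1.
Proof.
move=> y0 e0 ey; rewrite /powR gt_eqF; last by rewrite ltr_pwDl.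
apply: (@le_trans _ _ (expR (e * y))).
  by rewrite ler_expR ler_wpM2l// le_ln1Dx// (lt_le_trans _ y0)// ltrN10.
rewrite -(opprK (e * y)) expRN lef_pV2 ?posrE ?expR_gt0 ?opprK ?subr_gt0//.
exact: expR_ge1Dx.
Qed.

Lemma near_powRN (e eps : R) : 0 < e -> 0 < eps ->
  \forall t \near +oo, t `^ (- e) <= eps.
Proof.
move=> e0 eps0; near=> t.
have t0 : (eps^-1) `^ (e^-1) <= t by near: t; apply: nbhs_pinfty_ge; exact: num_real.
have h : eps^-1 <= t `^ e.
  have -> : eps^-1 = ((eps^-1) `^ (e^-1)) `^ e.
    by rewrite -powRrM mulVf ?gt_eqF// powRr1// invr_ge0 ltW.
  by rewrite ge0_ler_powR ?nnegrE ?powR_ge0 ?(le_trans _ t0) ?powR_ge0// ltW.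
rewrite powRN -(invrK eps) lef_pV2 ?posrE ?invr_gt0//.
by rewrite (lt_le_trans _ h) ?invr_gt0.
Unshelve. all: by end_near. Qed.

(** A mean value estimate whose leading constant is [e] up to [eta]. This sharpness is needed in
    [near_value_weight], where the constant competes with [a]. *)
Lemma near_powR_succ_sub (e eta : R) : 0 <= e -> 0 < eta ->
  \forall t \near +oo, (t + 1) `^ e - t `^ e <= (e + eta) * t `^ (e - 1).
Proof.
move=> e0 eta0; near=> t.
have t0 : 0 < t by near: t; apply: nbhs_pinfty_gt; exact: num_real.
(* Beyond this threshold [(1 - e y)^-1 <= 1 + (e + eta) y] holds for [y = t^-1]. *)
have t1 : (e + eta) * e / eta < t by near: t; apply: nbhs_pinfty_gt; exact: num_real.
have y0 : 0 < t^-1 by rewrite invr_gt0.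
have h : (e + eta) * (e * t^-1) <= eta.
  by rewrite mulrA ler_pdivrMr// [leRHS]mulrC -ler_pdivrMr// ltW.
have ey : e * t^-1 < 1.
  move: h y0; move: (t^-1) => y h y0.
  have [->|en0] := eqVneq e 0; first by rewrite mul0r ltr01.
  have e_gt0 : 0 < e by rewrite lt_def en0.
  have : 0 < e * (e * y) by rewrite !mulr_gt0.
  by move=> h2; rewrite -(ltr_pM2l eta0) mulr1; lra.
rewrite powR_succ// powR_add// powR_inv1 ?(ltW t0)//.
have -> (P Q : R) : P * Q - P = P * (Q - 1) by ring.
rewrite mulrCA ler_pM2l ?powR_gt0// lerBlDr.
apply: (le_trans (powR_1D_le (ltW y0) e0 ey)).
rewrite -[leLHS]mul1r ler_pdivrMr ?subr_gt0//.
by move: h y0; move: (t^-1) => y h y0; nra.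
Unshelve. all: by end_near. Qed.

Lemma near_powR_succ_le (e eta : R) : 0 <= e -> 0 < eta ->
  \forall t \near +oo, (t + 1) `^ e <= (1 + eta) * t `^ e.
Proof.
move=> e0 eta0; near=> t.
have t0 : 0 < t by near: t; apply: nbhs_pinfty_gt; exact: num_real.
have h : (t + 1) `^ e - t `^ e <= (e + 1) * t `^ (e - 1).
  by near: t; exact: near_powR_succ_sub.
have t1 : (e + 1) / eta < t by near: t; apply: nbhs_pinfty_gt; exact: num_real.
move: h; rewrite powR_add// powR_inv1 ?(ltW t0)// lerBlDr => /le_trans; apply.
have -> : (1 + eta) * t `^ e = eta * t `^ e + t `^ e by ring.
rewrite lerD2r mulrCA mulrC ler_pM2r ?powR_gt0//.
by rewrite ler_pdivrMr// [leRHS]mulrC -ler_pdivrMr// ltW.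
Unshelve. all: by end_near. Qed.

Lemma near_pinfty_succ (P : set R) :
  (\forall t \near +oo, P t) -> \forall t \near +oo, P (t + 1).
Proof.
case=> M [Mr hM]; exists M; split => // t /lt_trans Mt.
by apply: hM; apply: Mt; rewrite ltrDl.
Qed.

End Powers.

(** * Asymptotics of the weights *)

Section CoefficientArithmetic.
Context {R : realType}.

(** The leading term is [2 * X <= - (k * v)]. Half of it pays for the Young weight
    [2 * (k / 4 * v)], a quarter is kept, and the last quarter absorbs the lower-order terms. *)
Lemma velocity_coefficient_le (X m S e B T c1 C1 c2 k v y : R) :
  X <= - (k * v / 2) -> 0 < m -> S <= c1 -> - e <= C1 -> B <= y ->
  y <= k / 48 * v -> T <= c2 -> 0 < k * v -> c1 + 2 * C1 + 9 * c2 <= v * (k / 8) ->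
  2 * X - m + S + 2 * (k / 4 * v) - 2 * e + 3 * B + 9 * T <= - (k / 4 * v).
Proof. lra. Qed.

Lemma distance_coefficient_le (P A T C1 C2 A2 c2 d r : R) :
  P <= C1 * r -> A <= A2 * r -> T <= c2 * r -> 0 <= C2 * r -> 0 <= d * r ->
  P + 3 * A + 9 * T <= (C1 + C2 + 3 * A2 + 9 * c2 + d) * r.
Proof. lra. Qed.

Lemma anchor_coefficient_le (P X T C1 C2 A2 c2 d r r' : R) :
  P <= C2 * r -> 0 <= X -> X <= d * r' -> T <= c2 * r ->
  0 <= C2 * r' -> 0 <= d * r -> 0 <= C1 * (r' + r) -> 0 <= A2 * (r' + r) ->
  0 <= c2 * r' ->
  2^-1 * X + P + 9 * T <= (C1 + C2 + 3 * A2 + 9 * c2 + d) * (r' + r).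
Proof. lra. Qed.

(** The new distance splits into the old one, which the energy controls, and the velocity, which
    half of the dissipation pays for once [t] is large. *)
Lemma absorb_velocity (C n r t kap E DD DD0 VV : R) :
  0 <= C -> 0 < n -> 0 <= r <= 1 -> 0 < kap -> 4 * C / kap <= t -> 0 <= VV ->
  DD <= 2 * DD0 + 2 * VV -> n * DD0 <= E ->
  C * r * DD <= 2 * C / n * r * E + kap / 2 * (t * VV).
Proof.
move=> C0 n0 /andP[r0 r1] kap0 big VV0 hDD hE.
have Cr : 0 <= C * r by rewrite mulr_ge0.
have h1 := ler_wpM2l Cr hDD.
have h2 : 2 * C / n * r * (n * DD0) <= 2 * C / n * r * E.
  by rewrite ler_wpM2l// mulr_ge0// divr_ge0 ?mulr_ge0// ltW.
have h3 : 2 * C / n * r * (n * DD0) = C * r * (2 * DD0) by field; rewrite gt_eqF.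
have hC : C * r <= C by rewrite ler_piMr.
have h4 : 2 * (C * r) <= kap / 2 * t by move: big; rewrite ler_pdivrMr//; lra.
by have := ler_wpM2r VV0 h4; move: h1; rewrite mulrDr -h3; lra.
Qed.

End CoefficientArithmetic.

Section Weights.
Context {R : realType}.
Variables (al c q p de a n rho : R).
Hypotheses (al_gt0 : 0 < al) (c_gt0 : 0 < c) (q_gt0 : 0 < q) (q_le1 : q <= 1).
Hypotheses (qp : q + 1 <= p) (de_ge0 : 0 <= de).
Hypotheses (rho_gt0 : 0 < rho) (rho_le_q : rho <= q).
Hypothesis a_gt : q + 1 + de < a.
(** [n] cancels the limit of [wA t * wb (t + 1) + wB t * wa (t + 1)], the main part of the mixed
    distance-velocity coefficient; [rho] is the decay rate of what remains. *)
Hypothesis n_spec : [/\ q < 1, n = a * al & rho <= 1 - q] \/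
  [/\ q = 1, a < al - 1 & n = a * (al - a - 1)].

Let s : R := (q + 1) / 2.

(* The energy uses [W k = wa k *: (x k - z) + wb k *: (x k - x k.-1)];
   [wb t = t `^ s * (1 - al / t `^ q)], so that the recursion expresses [W k]
   through [x k.+1] without dividing by [alpha_ k]. *)
Definition wa (t : R) : R := a * t `^ (s - 1).
Definition wb (t : R) : R := t `^ s - al * t `^ (s - q).
(** [wA], [wB] and [- tik] are the coefficients of [D_{k+1}], [V_{k+1}] and [x_k] in
    [W_{k+1} - W_k]. *)
Definition wA (t : R) : R := wa (t + 1) - wa t.
Definition wB (t : R) : R := wa t + wb (t + 1) - t `^ s.
Definition tik (t : R) : R := t `^ s * (c / t `^ p).
Definition sig (t : R) : R := c * t `^ (q + 1 - p).
(** [err_x] and [err_D] are half the coefficients of [<z, V_{k+1}>] and [<D_{k+1}, V_{k+1}>] in the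
    expanded energy difference; [sig] and [n] are chosen to make them small. *)
Definition err_x (t : R) : R := sig t - tik t * wb (t + 1).
Definition err_D (t : R) : R :=
  wA t * wb (t + 1) + wB t * wa (t + 1) + n + tik t * wa (t + 1) + err_x t.

Let a_gt0 : 0 < a.
Proof. by move: q_gt0 de_ge0 a_gt; lra. Qed.

Lemma wa_ge0 t : 0 <= wa t.
Proof. by rewrite mulr_ge0 ?powR_ge0// ltW. Qed.

Lemma wa_noninc t : 0 < t -> wa (t + 1) <= wa t.
Proof.
by move=> t0; rewrite ler_pM2l// powR_succ_le// /s; move: q_le1; lra.
Qed.

Lemma wA_le0 t : 0 < t -> wA t <= 0.
Proof. by move=> t0; rewrite subr_le0 wa_noninc. Qed.

Lemma wA_ge t : 0 < t -> - (a * t `^ (s - 1 - 1)) <= wA t.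
Proof.
move=> t0; have : t `^ (s - 1) - t `^ (s - 1 - 1) <= (t + 1) `^ (s - 1).
  by apply: powR_succ_geN1 => //; rewrite /s; move: q_gt0; lra.
by rewrite -(ler_pM2l a_gt0) /wA /wa mulrBr; lra.
Qed.

Lemma near_wb_ge : \forall t \near +oo, t `^ s / 2 <= wb t.
Proof.
near=> t.
have t0 : 0 < t by near: t; apply: nbhs_pinfty_gt; exact: num_real.
have h : t `^ (- q) <= (2 * al)^-1.
  by near: t; apply: near_powRN => //; rewrite invr_gt0 mulr_gt0.
have h3 : (2 * al)^-1 * al = 2^-1 by field; rewrite gt_eqF.
have h4 : 0 < t `^ s by rewrite powR_gt0.
rewrite /wb powR_add//.
move: h; rewrite -(ler_pM2r al_gt0) h3 => h.
have : t `^ s * (t `^ (- q) * al) <= t `^ s * 2^-1 by rewrite ler_pM2l.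
lra.
Unshelve. all: by end_near. Qed.

Lemma near_wb_succ_ge : \forall t \near +oo, t `^ s / 2 <= wb (t + 1).
Proof.
near=> t.
have t0 : 0 < t by near: t; apply: nbhs_pinfty_gt; exact: num_real.
apply: (@le_trans _ _ ((t + 1) `^ s / 2)).
  by rewrite ler_pM2r// powR_succ_ge// /s; move: q_gt0; lra.
by near: t; apply: (near_pinfty_succ (P := fun t => t `^ s / 2 <= wb t)); exact: near_wb_ge.
Unshelve. all: by end_near. Qed.

Lemma wb_le t : 1 <= t -> wb (t + 1) <= 2 * t `^ s.
Proof.
move=> t1; have t0 : 0 < t by rewrite (lt_le_trans _ t1).
have s1 : s <= 1 by rewrite /s; move: q_le1; lra.
have h := powR_succ_le1 t0 s1.
have h1 : t `^ (s - 1) <= t `^ s by rewrite ler_powR// gerBl.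
have h2 : 0 <= al * (t + 1) `^ (s - q) by rewrite mulr_ge0 ?powR_ge0// ltW.
rewrite /wb; lra.
Qed.

(* [wB t * wb (t + 1)] is, up to a factor 2, the damping coefficient of
   the squared velocity. *)
Lemma near_wB : exists K C : R, 0 < K /\ \forall t \near +oo,
  wB t <= - (K * t `^ (s - q)) /\ wB t ^+ 2 <= C * t `^ (1 - q).
Proof.
case: n_spec => [[q_lt1 _ _]|[q1 al_gt _]]; last first.
  (* At [q = 1] one has [s = 1], so [wa] is constant, [wb] is affine and [wB] is the constant
     [- (al - a - 1)]. *)
  exists (al - a - 1), ((al - a - 1) ^+ 2); split; first by move: al_gt; lra.
  near=> t.
  have t0 : 0 < t by near: t; apply: nbhs_pinfty_gt; exact: num_real.
  have -> : wB t = - (al - a - 1).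
    have s1 : s = 1 by rewrite /s q1; lra.
    rewrite /wB /wa /wb s1 q1 subrr !powRr0 !powRr1; last 2 first.
    - exact: ltW.
    - by rewrite addr_ge0// ltW.
    by ring.
  have -> : s - q = 0 by rewrite /s q1; lra.
  by rewrite q1 subrr !powRr0 !mulr1 sqrrN.
exists (al / 2), ((2 * al) ^+ 2); split; first by rewrite divr_gt0.
near=> t.
have t0 : 0 < t by near: t; apply: nbhs_pinfty_gt; exact: num_real.
have t1 : 1 <= t by near: t; apply: nbhs_pinfty_ge; exact: num_real.
(* In [a + 1], the part [a] stands for [wa t] and 1 for the increment of [t ^ s]; since [q < 1],
   both are dominated by [al t ^ (s - q)]. *)
have small : t `^ (- (1 - q)) <= al / 2 / (a + 1).
  near: t; apply: near_powRN; first by rewrite subr_gt0.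
  by rewrite !divr_gt0// addr_gt0.
set G := t `^ (s - q).
have G0 : 0 < G by rewrite powR_gt0.
have hQ : (a + 1) * t `^ (s - 1) <= al / 2 * G.
  have -> : s - 1 = (s - q) + - (1 - q) by lra.
  rewrite powR_add// -/G.
  have : G * (t `^ (- (1 - q)) * (a + 1)) <= G * (al / 2).
    by rewrite ler_pM2l// -ler_pdivlMr// addr_gt0.
  lra.
have Q0 : 0 < t `^ (s - 1) by rewrite powR_gt0.
have hs : (t + 1) `^ s <= t `^ s + t `^ (s - 1).
  by apply: powR_succ_le1 => //; rewrite /s; move: q_le1; lra.
have hs' : t `^ s <= (t + 1) `^ s.
  by apply: powR_succ_ge => //; rewrite /s; move: q_gt0; lra.
have hG : (t + 1) `^ (s - q) <= G + t `^ (s - q - 1).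
  by apply: powR_succ_le1 => //; rewrite /s; move: q_gt0; lra.
have hG1 : t `^ (s - q - 1) <= G by rewrite /G ler_powR// gerBl.
have hG' : G <= (t + 1) `^ (s - q).
  by apply: powR_succ_ge => //; rewrite /s; move: q_le1; lra.
have alG : al * G <= al * (t + 1) `^ (s - q) by rewrite ler_pM2l.
have alG2 : al * (t + 1) `^ (s - q) <= al * (2 * G) by rewrite ler_pM2l//; lra.
have aQ : 0 < a * t `^ (s - 1) by rewrite mulr_gt0.
have B1 : wB t <= - (al / 2 * G) by rewrite /wB /wa /wb; lra.
have B2 : - (2 * al * G) <= wB t by rewrite /wB /wa /wb; lra.
split => //.
have -> : 1 - q = (s - q) + (s - q) by rewrite /s; lra.
rewrite powR_add// -/G -expr2.
have alG0 : 0 < al * G by rewrite mulr_gt0.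
by rewrite -exprMn -[leLHS]sqrrN ler_pXn2r ?nnegrE//; lra.
Unshelve. all: by end_near. Qed.

(** At [q = 1] the sum vanishes identically. For [q < 1] the constant [- a * al] inside
    [wB t * wa (t + 1)] is cancelled by [n], and what is left has order [t ^ (q - 1)], where
    [rho <= 1 - q]. *)
Lemma near_cross : exists C : R, \forall t \near +oo,
  `|wA t * wb (t + 1) + wB t * wa (t + 1) + n| <= C * t `^ (- rho).
Proof.
case: n_spec => [[q_lt1 n_eq rho_le]|[q1 _ n_eq]]; last first.
  exists 0; near=> t.
  have t0 : 0 < t by near: t; apply: nbhs_pinfty_gt; exact: num_real.
  have s1 : s = 1 by rewrite /s q1; lra.
  rewrite mul0r /wA /wB /wa /wb s1 q1 n_eq subrr !powRr0 !powRr1; last 2 first.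
  - exact: ltW.
  - by rewrite addr_ge0// ltW.
  by rewrite [X in `|X|](_ : _ = 0) ?normr0//; ring.
exists (2 * a + a * (a + 1)); near=> t.
have t1 : 1 <= t by near: t; apply: nbhs_pinfty_ge; exact: num_real.
have t0 : 0 < t by rewrite (lt_le_trans _ t1).
apply: (@le_trans _ _ ((2 * a + a * (a + 1)) * t `^ (q - 1))); last first.
  rewrite ler_pM2l ?ler_powR//; first by lra.
  by rewrite addr_gt0 ?mulr_gt0 ?addr_gt0.
have b0 : t `^ s / 2 <= wb (t + 1) by near: t; exact: near_wb_succ_ge.
have b1 := wb_le t1.
have A0 := wA_le0 t0; have A1 := wA_ge t0.
have ts : 0 < t `^ s by rewrite powR_gt0.
have e1 : t `^ (q - 1) = t `^ (s - 1 - 1) * t `^ s.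
  by rewrite -powR_add//; congr (_ `^ _); rewrite /s; lra.
have e2 : t `^ (q - 1) = t `^ (s - 1) * t `^ (s - 1).
  by rewrite -powR_add//; congr (_ `^ _); rewrite /s; lra.
have first_le : - (2 * a * t `^ (q - 1)) <= wA t * wb (t + 1) <= 0.
  have bpos : 0 <= wb (t + 1) by apply: le_trans b0; rewrite divr_ge0// ltW.
  have T0 : 0 <= a * t `^ (s - 1 - 1) by rewrite mulr_ge0 ?powR_ge0// ltW.
  apply/andP; split; last by rewrite mulr_le0_ge0.
  rewrite e1; have := ler_wpM2r bpos A1; have := ler_wpM2l T0 b1; lra.
have hs : (t + 1) `^ s <= t `^ s + t `^ (s - 1).
  by apply: powR_succ_le1 => //; rewrite /s; move: q_le1; lra.
have hs' : t `^ s <= (t + 1) `^ s.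
  by apply: powR_succ_ge => //; rewrite /s; move: q_gt0; lra.
(* The exponents add up to [2 s - q - 1 = 0], so the term that [n] cancels is exactly constant. *)
have e3 : (t + 1) `^ (s - q) * (t + 1) `^ (s - 1) = 1.
  rewrite -powR_add ?addr_gt0//.
  have -> : s - q + (s - 1) = 0 by rewrite /s; lra.
  by rewrite powRr0.
have second : wB t * wa (t + 1) + n =
  (wa t + ((t + 1) `^ s - t `^ s)) * wa (t + 1).
  rewrite /wB /wb n_eq {2}/wa.
  transitivity ((wa t + ((t + 1) `^ s - t `^ s)) * wa (t + 1)
    - a * al * ((t + 1) `^ (s - q) * (t + 1) `^ (s - 1) - 1)).
    by rewrite /wa; ring.
  by rewrite e3 subrr mulr0 subr0.
have wa1 := wa_noninc t0; have wa0 := wa_ge0 (t + 1); have wa0' := wa_ge0 t.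
have second_le : 0 <= wB t * wa (t + 1) + n <= a * (a + 1) * t `^ (q - 1).
  rewrite second; apply/andP; split; first by rewrite mulr_ge0// addr_ge0// subr_ge0.
  rewrite e2 [leRHS](_ : _ = ((a + 1) * t `^ (s - 1)) * wa t); last by rewrite /wa; ring.
  rewrite ler_pM//; first by rewrite addr_ge0// subr_ge0.
  by rewrite {1}/wa; lra.
move: first_le second_le => /andP[f1 f2] /andP[g1 g2].
have Z0 : 0 <= a * (a + 1) * t `^ (q - 1).
  exact: le_trans g2.
have Z1 : 0 <= 2 * a * t `^ (q - 1) by lra.
by rewrite -addrA ler_norml; apply/andP; split; lra.
Unshelve. all: by end_near. Qed.

(** To leading order the left-hand side is [(2 s + de - a) t ^ (q + de)]: the increment of
    [t ^ (2 s + de)] against the contribution [a] of [wa]. As [2 s = q + 1], the hypothesis on [a]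
    makes it negative. *)
Lemma near_value_weight : exists2 K : R, 0 < K & \forall t \near +oo,
  (t + 1) `^ (s + de) * wb (t + 1 + 1) - t `^ (s + de) * (wb (t + 1) + wa (t + 1))
    <= - (K * t `^ (q + de)).
Proof.
pose gap : R := a - (q + 1 + de).
have gap0 : 0 < gap by rewrite subr_gt0.
(* With [eta ^ 2 <= eta], the errors in [coef] add up to at most [eta * (q + de + 5 + a)]; this
   choice lets them use half of the gap. *)
pose eta : R := gap / (2 * (q + de + 5 + a)).
have D0 : 0 < q + de + 5 + a by move: q_gt0 de_ge0 a_gt0; lra.
have eta0 : 0 < eta by rewrite divr_gt0 ?mulr_gt0.
have eta_eq : eta * (q + de + 5 + a) = gap / 2 by rewrite /eta; field; rewrite gt_eqF.
have eta1 : eta < 1.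
  by rewrite -(ltr_pM2r D0) eta_eq mul1r /gap; move: q_gt0 de_ge0 a_gt0; lra.
exists (gap / 2); first by rewrite divr_gt0.
have s0 : 0 <= s by rewrite /s; move: q_gt0; lra.
have sde0 : 0 <= s + de by rewrite addr_ge0.
near=> t.
have t1 : 1 <= t by near: t; apply: nbhs_pinfty_ge; exact: num_real.
have t0 : 0 < t by rewrite (lt_le_trans _ t1).
have te : eta^-1 < t by near: t; apply: nbhs_pinfty_gt; exact: num_real.
have t10 : 0 < t + 1 by rewrite addr_gt0.
have s1 : -1 <= s - 1 by rewrite lerBrDr addNr.
have s1' : s - 1 <= 0 by rewrite /s; move: q_le1; lra.
pose P := t `^ (s + de); pose Q := t `^ (s - 1).
have P0 : 0 < P by rewrite powR_gt0.
have Q0 : 0 < Q by rewrite powR_gt0.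
have PQ : t `^ (q + de) = P * Q.
  by rewrite -powR_add//; congr (_ `^ _); rewrite /s; lra.
have Pt : t `^ (s + de - 1) = P / t by rewrite powR_add// powR_inv1 ?(ltW t0).
have Qt : t `^ s = Q * t.
  by rewrite -[X in _ = _ * X](powRr1 (ltW t0)) -powR_add//; congr (_ `^ _); lra.
have h1 : (t + 1 + 1) `^ s - (t + 1) `^ s <= (s + eta) * Q.
  apply: (@le_trans _ _ ((s + eta) * (t + 1) `^ (s - 1))); last first.
    by rewrite ler_pM2l ?powR_succ_le// ltr_wpDl.
  near: t.
  apply: (near_pinfty_succ (P := fun u =>
    (u + 1) `^ s - u `^ s <= (s + eta) * u `^ (s - 1))).
  exact: near_powR_succ_sub.
have h2 : (t + 1) `^ (s + de) - P <= (s + de + eta) * (P / t).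
  by rewrite -Pt /P; near: t; exact: near_powR_succ_sub.
have h3 : (t + 1) `^ (s + de) <= (1 + eta) * P by rewrite /P; near: t; exact: near_powR_succ_le.
have h4 : (t + 1) `^ s <= (1 + eta) * (Q * t).
  by rewrite -Qt; near: t; exact: near_powR_succ_le.
have h5 : (1 - eta) * Q <= (t + 1) `^ (s - 1).
  apply: le_trans (powR_succ_geN1 t0 s1).
  have -> : t `^ (s - 1 - 1) = t^-1 * Q.
    by rewrite mulrC powR_add// powR_inv1 ?(ltW t0).
  have : t^-1 * Q <= eta * Q.
    by rewrite ler_pM2r// -[leRHS]invrK lef_pV2 ?posrE ?invr_gt0// ltW.
  by rewrite -/Q; lra.
have hb : wb (t + 1 + 1) - wb (t + 1) <= (t + 1 + 1) `^ s - (t + 1) `^ s.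
  have : al * (t + 1) `^ (s - q) <= al * (t + 1 + 1) `^ (s - q).
    by rewrite ler_pM2l// powR_succ_ge// /s; move: q_le1; lra.
  rewrite /wb; lra.
have hb1 : wb (t + 1) <= (1 + eta) * (Q * t).
  apply: le_trans h4; rewrite /wb gerBl mulr_ge0 ?powR_ge0//; exact: ltW.
have hP1 : P <= (t + 1) `^ (s + de) by exact: powR_succ_ge.
have step1 : (t + 1) `^ (s + de) * (wb (t + 1 + 1) - wb (t + 1))
    <= (1 + eta) * (s + eta) * (P * Q).
  apply: (@le_trans _ _ ((t + 1) `^ (s + de) * ((s + eta) * Q))).
    by rewrite ler_pM2l ?powR_gt0//; exact: (le_trans hb).
  have : 0 <= (s + eta) * Q by rewrite mulr_ge0 ?addr_ge0// ltW.
  by move=> /ler_wpM2r/(_ _ _ h3); lra.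
have step2 : ((t + 1) `^ (s + de) - P) * wb (t + 1)
    <= (s + de + eta) * (1 + eta) * (P * Q).
  apply: (@le_trans _ _ ((s + de + eta) * (P / t) * ((1 + eta) * (Q * t)))).
    apply: (@le_trans _ _ (((t + 1) `^ (s + de) - P) * ((1 + eta) * (Q * t)))).
      by rewrite ler_wpM2l// subr_ge0.
    by rewrite ler_wpM2r// !mulr_ge0 ?addr_ge0// ltW.
  have -> : (s + de + eta) * (P / t) * ((1 + eta) * (Q * t)) =
    (s + de + eta) * (1 + eta) * (P * Q) by field; rewrite gt_eqF.
  by [].
have step3 : a * (1 - eta) * (P * Q) <= P * wa (t + 1).
  have : P * ((1 - eta) * Q) <= P * (t + 1) `^ (s - 1) by rewrite ler_pM2l.
  by rewrite -(ler_pM2l a_gt0) /wa; lra.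
have coef : (1 + eta) * (s + eta) + (s + de + eta) * (1 + eta) - a * (1 - eta)
    <= - (gap / 2).
  have ee : eta * eta <= eta by rewrite ler_piMl// ltW.
  by have := eta_eq; rewrite /gap /s; lra.
have PQ0 : 0 <= P * Q by rewrite mulr_ge0 ?ltW.
have := ler_wpM2r PQ0 coef; rewrite PQ -/P; lra.
Unshelve. all: by end_near. Qed.

(** [sig t] equals [tik t * t ^ s], so [err_x t] is [tik t] times [t ^ s - wb (t + 1)], of order
    [t ^ (1 - p)] with [1 - p <= - q <= - rho]. The weight [t ^ (q - p)] is the one that fails to be
    summable at [p = q + 1]. *)
Lemma near_tikhonov : exists C : R, \forall t \near +oo,
  [/\ 0 <= tik t * wa (t + 1) <= a * c * t `^ (q - p),
      `|err_x t| <= C * t `^ (- rho) & tik t ^+ 2 <= c ^+ 2 * t `^ (-1 - rho)].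
Proof.
exists (c * (1 + 2 * al)); near=> t.
have t1 : 1 <= t by near: t; apply: nbhs_pinfty_ge; exact: num_real.
have t0 : 0 < t by rewrite (lt_le_trans _ t1).
rewrite /err_x /sig; have -> : tik t = c * t `^ (s - p).
  by rewrite /tik powR_add// powRN; ring.
have cs : 0 < c * t `^ (s - p) by rewrite mulr_gt0 ?powR_gt0.
split.
- rewrite mulr_ge0 ?wa_ge0 ?(ltW cs)//=.
  apply: (@le_trans _ _ (c * t `^ (s - p) * wa t)).
    by rewrite ler_pM2l// wa_noninc.
  rewrite /wa (_ : q - p = s - p + (s - 1)); last by rewrite /s; lra.
  rewrite (powR_add (s - p) (s - 1) t0); have -> (x y : R) : c * x * (a * y) = a * c * (x * y) by ring.
  by [].
- have -> : c * t `^ (q + 1 - p) = c * t `^ (s - p) * t `^ s.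
    rewrite -mulrA -powR_add//; congr (_ * _ `^ _); rewrite /s; lra.
  rewrite -mulrBr normrM (gtr0_norm cs) -!mulrA ler_pM2l//.
  have hs : (t + 1) `^ s <= t `^ s + t `^ (s - 1).
    by apply: powR_succ_le1 => //; rewrite /s; move: q_le1; lra.
  have hs' : t `^ s <= (t + 1) `^ s.
    by apply: powR_succ_ge => //; rewrite /s; move: q_gt0; lra.
  have hG : (t + 1) `^ (s - q) <= t `^ (s - q) + t `^ (s - q - 1).
    by apply: powR_succ_le1 => //; rewrite /s; move: q_gt0; lra.
  have hG1 : t `^ (s - q - 1) <= t `^ (s - q) by rewrite ler_powR// gerBl.
  have hQG : t `^ (s - 1) <= t `^ (s - q) by rewrite ler_powR// lerB.
  have b1 : `|t `^ s - wb (t + 1)| <= (1 + 2 * al) * t `^ (s - q).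
    have : al * (t + 1) `^ (s - q) <= al * (2 * t `^ (s - q)).
      by rewrite ler_pM2l//; lra.
    have : 0 <= al * (t + 1) `^ (s - q) by rewrite mulr_ge0 ?powR_ge0// ltW.
    have : 0 < t `^ (s - q) by rewrite powR_gt0.
    by move=> *; rewrite ler_norml /wb; apply/andP; split; lra.
  apply: (@le_trans _ _ (t `^ (s - p) * ((1 + 2 * al) * t `^ (s - q)))).
    by rewrite ler_pM2l ?powR_gt0.
  rewrite mulrCA ler_pM2l; last by rewrite addr_gt0 ?mulr_gt0.
  by rewrite -powR_add// ler_powR//; move: rho_le_q qp; rewrite /s; lra.
- rewrite exprMn ler_pM2l ?exprn_gt0// expr2 -powR_add// ler_powR//.
  by move: rho_le_q qp; rewrite /s; lra.
Unshelve. all: by end_near. Qed.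

(** These are the coefficients of [|V_{k+1}|^2], [|D_{k+1}|^2] and [|z|^2] in [energy_step] with
    Young weight [w = kap * t]. Dividing the squared errors by [kap * t] gains the factor [t^-1]
    that makes them summable. *)
Lemma near_step_coefficients : exists kap C : R, [/\ 0 < kap, 0 <= C &
  \forall t \near +oo,
  [/\ 2 * (wB t * wb (t + 1)) - n + sig t + 2 * (kap * t) - 2 * err_x t
        + 3 * wB t ^+ 2 + 9 * tik t ^+ 2 <= - (kap * t),
      err_D t ^+ 2 / (kap * t) + 3 * wA t ^+ 2 + 9 * tik t ^+ 2 <= C * t `^ (-1 - rho)
    & 2^-1 * (tik t * wa (t + 1)) + err_x t ^+ 2 / (kap * t) + 9 * tik t ^+ 2
        <= C * (t `^ (q - p) + t `^ (-1 - rho))]].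
Proof.
have [K [CB [K0 nearB]]] := near_wB.
have [Cx nearx] := near_cross.
have [Ct neart] := near_tikhonov.
pose kap : R := K / 4; have kap0 : 0 < kap by rewrite divr_gt0.
pose C3 := Cx + a * c + Ct.
pose C := C3 ^+ 2 / kap + Ct ^+ 2 / kap + 3 * a ^+ 2 + 9 * c ^+ 2 + a * c.
have ac0 : 0 < a * c by rewrite mulr_gt0.
have sq0 (y : R) : 0 <= y ^+ 2 / kap by rewrite divr_ge0 ?sqr_ge0// ltW.
have s3 := sq0 C3; have st := sq0 Ct; have sa := sqr_ge0 a; have sc := sqr_ge0 c.
have n0 : 0 < n.
  case: n_spec => [[_ -> _]|[_ h ->]]; first by rewrite mulr_gt0.
  by rewrite mulr_gt0//; move: h; lra.
exists kap, C; split => //; first by rewrite /C; lra.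
near=> t.
have t1 : 1 <= t by near: t; apply: nbhs_pinfty_ge; exact: num_real.
have t0 : 0 < t by rewrite (lt_le_trans _ t1).
have w0 : 0 < kap * t by rewrite mulr_gt0.
have [B1 B2] : wB t <= - (K * t `^ (s - q)) /\ wB t ^+ 2 <= CB * t `^ (1 - q).
  by near: t.
have xC : `|wA t * wb (t + 1) + wB t * wa (t + 1) + n| <= Cx * t `^ (- rho).
  by near: t.
have [/andP[T1 T1'] T2 T3] : [/\ 0 <= tik t * wa (t + 1) <= a * c * t `^ (q - p),
  `|err_x t| <= Ct * t `^ (- rho) & tik t ^+ 2 <= c ^+ 2 * t `^ (-1 - rho)].
  by near: t.
have b0 : t `^ s / 2 <= wb (t + 1) by near: t; exact: near_wb_succ_ge.
have ts0 : 0 < t `^ s by rewrite powR_gt0.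
have rho1 : t `^ (- rho) <= 1.
  by rewrite powR_le1// oppr_le0 ltW.
have rho2 : t `^ (-1 - rho) <= 1.
  by apply: powR_le1 => //; move: rho_gt0; lra.
have pr0 : 0 < t `^ (-1 - rho) by rewrite powR_gt0.
have pq0 : 0 < t `^ (q - p) by rewrite powR_gt0.
have pq1 : t `^ (q - p) <= t `^ (- rho).
  by rewrite ler_powR//; move: qp rho_le_q q_le1; lra.
have r0 : 0 < t `^ (- rho) by rewrite powR_gt0.
have Ct0 : 0 <= Ct by rewrite -(pmulr_lge0 _ r0) (le_trans _ T2).
have sg0 : 0 <= sig t <= c.
  rewrite /sig mulr_ge0 ?powR_ge0 ?(ltW c_gt0)//= -[leRHS]mulr1 ler_pM2l//.
  by apply: powR_le1 => //; move: qp; lra.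
(* One factor [t ^ (- rho)] is enough for the target; the other one is bounded by 1. *)
have sq_le (e L : R) : `|e| <= L * t `^ (- rho) -> e ^+ 2 / (kap * t) <= L ^+ 2 / kap * t `^ (-1 - rho).
  move=> he.
  have L0 : 0 <= L * t `^ (- rho) by exact: le_trans he.
  have : e ^+ 2 <= (L * t `^ (- rho)) ^+ 2.
    by rewrite -real_normK ?num_real// ler_pXn2r ?nnegrE.
  rewrite exprMn [_ `^ _ ^+ 2]expr2 => h.
  have h2 : t `^ (- rho) * t `^ (- rho) <= t `^ (- rho).
    by rewrite ler_piMr// ltW.
  have -> : L ^+ 2 / kap * t `^ (-1 - rho) = L ^+ 2 * t `^ (- rho) / (kap * t).
    rewrite (powR_add (-1) (- rho) t0) powR_inv1 ?(ltW t0)//.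
    by field; rewrite !gt_eqF.
  rewrite ler_pM2r ?invr_gt0//; apply: (le_trans h).
  by rewrite ler_wpM2l ?sqr_ge0.
have e3_le : `|err_D t| <= C3 * t `^ (- rho).
  have h4 : a * c * t `^ (q - p) <= a * c * t `^ (- rho) by rewrite ler_pM2l.
  move: xC T2; rewrite /err_D /C3 !ler_norml.
  by move=> /andP[x1 x2] /andP[y1 y2]; apply/andP; split; lra.
have A_le : wA t ^+ 2 <= a ^+ 2 * t `^ (-1 - rho).
  have A0 := wA_le0 t0; have A1 := wA_ge t0.
  have : wA t ^+ 2 <= (a * t `^ (s - 1 - 1)) ^+ 2.
    rewrite -[leLHS]sqrrN ler_pXn2r ?nnegrE ?oppr_ge0 ?mulr_ge0 ?powR_ge0 ?(ltW a_gt0)//.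
    by rewrite lerNl.
  move=> /le_trans; apply.
  rewrite exprMn ler_pM2l ?exprn_gt0// expr2 -powR_add// ler_powR//.
  by rewrite /s; move: q_le1 rho_le_q; lra.
split.
- have Bb : wB t * wb (t + 1) <= - (K * t / 2).
    have bpos : 0 <= wb (t + 1) by apply: le_trans b0; rewrite divr_ge0// ltW.
    apply: (le_trans (ler_wpM2r bpos B1)).
    have -> : K * t / 2 = K * t `^ (s - q) * (t `^ s / 2).
      rewrite -[X in _ * X / _](powRr1 (ltW t0)) (_ : 1 = (s - q) + s); last by rewrite /s; lra.
      by rewrite powR_add//; ring.
    by rewrite mulNr lerN2 ler_wpM2l// mulr_ge0 ?powR_ge0// ltW.
  (* As [q > 0], [wB t ^+ 2] is of lower order than [t]; with 48, three times it takes [K * t / 16]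
     of the quarter reserved for lower-order terms. *)
  have small : CB * t `^ (1 - q) <= K / 48 * t.
    have : t `^ (- q) <= K / 48 / (`|CB| + 1).
      by near: t; apply: near_powRN => //; rewrite !divr_gt0// ltr_wpDl.
    rewrite ler_pdivlMr ?ltr_wpDl// => h.
    rewrite powR_add// powRr1 ?(ltW t0)// mulrCA [leRHS]mulrC ler_pM2l//.
    apply: le_trans h; rewrite mulrC ler_wpM2l ?powR_ge0//.
    by rewrite (le_trans (ler_norm _))// lerDl.
  have big : (c + 2 * Ct + 9 * c ^+ 2) / (K / 8) <= t.
    by near: t; apply: nbhs_pinfty_ge; exact: num_real.
  move: big; rewrite ler_pdivrMr ?divr_gt0// => big.
  have e2b : - err_x t <= Ct.
    move: T2; rewrite ler_norml => /andP[y1 _].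
    rewrite lerNl; apply: le_trans y1.
    by rewrite lerN2 ler_piMr.
  have bcb : tik t ^+ 2 <= c ^+ 2.
    by apply: (le_trans T3); rewrite ler_piMr.
  case/andP: sg0 => _ sgc.
  by apply: (velocity_coefficient_le Bb n0 sgc e2b B2 small bcb _ big); rewrite mulr_gt0.
- by apply: distance_coefficient_le; [exact: sq_le|exact: A_le|exact: T3|
    rewrite mulr_ge0// ltW..].
- by apply: anchor_coefficient_le; [exact: sq_le|exact: T1|exact: T1'|exact: T3|
    rewrite mulr_ge0 ?addr_ge0// ltW..].
Unshelve. all: by end_near. Qed.

End Weights.

(** * One step of the energy *)

Section EnergyStep.
Context {R : realType} {H : completeNormedModType R}.
Variable dot : {dot H for idfun}.
Hypothesis Hdot : induces_norm dot.

Lemma dot_triangle3 (x y z : H) :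
  dot (x + y - z) (x + y - z) <= 3 * (dot x x + dot y y + dot z z).
Proof.
have := dot_ge0 Hdot (x - y); have := dot_ge0 Hdot (x + z).
have := dot_ge0 Hdot (y + z); rewrite !dotE (dotC dot y x) (dotC dot z x) (dotC dot z y).
lra.
Qed.

(** This is [|2 x - y|^2 >= 0]; it extracts half of the squared subgradient term from the increment
    of [W]. *)
Lemma dot_sub_ge (x y : H) : 2^-1 * dot y y - dot x x <= dot (x - y) (x - y).
Proof.
have := dot_ge0 Hdot (2 *: x - y); rewrite !dotE (dotC dot y x); lra.
Qed.

(** [W0] is [W_k] rewritten by the recursion in the new distance [D], velocity [v] and subgradient
    [u]. The subgradient inequalities give the terms in [g0] and [g1], Young's inequality with
    weight [w] handles [<D, v>] and [<z, v>], and [- |W1 - W0|^2] yields the negative term in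
    [u]. *)
Lemma energy_step (D v u z : H) (a0 a1 b1 be la cc n sg g0 g1 w : R) :
  let A := a1 - a0 in let B := a0 + b1 - be in let x := z + D - v in
  let W0 := a0 *: (D - v) + be *: (v + la *: u + cc *: x) in
  let W1 := a1 *: D + b1 *: v in
  let e2 := sg - be * cc * b1 in
  let e3 := A * b1 + B * a1 + n + be * cc * a1 + e2 in
  0 < w -> 0 <= be * la -> 0 <= a1 -> 0 <= b1 -> A <= 0 -> 0 <= be * cc * a1 ->
  g1 <= dot D u -> g1 - g0 <= dot v u ->
  dot W1 W1 + n * dot D D + sg * dot (z + D) (z + D) <=
  dot W0 W0 + n * dot (D - v) (D - v) + sg * dot x x
  - 2 * (be * la) * (a1 * g1 + b1 * (g1 - g0))
  + (2 * (B * b1) - n + sg + 2 * w - 2 * e2 + 3 * B ^+ 2 + 9 * (be * cc) ^+ 2) * dot v v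
  + (e3 ^+ 2 / w + 3 * A ^+ 2 + 9 * (be * cc) ^+ 2) * dot D D
  + (2^-1 * (be * cc * a1) + e2 ^+ 2 / w + 9 * (be * cc) ^+ 2) * dot z z
  - 2^-1 * (be * la) ^+ 2 * dot u u.
Proof.
move=> A B x W0 W1 e2 e3 w0 bl0 a10 b10 A0 bca gD gv.
have yD := young_dot Hdot e3 D v w0.
have yz := young_dot Hdot e2 z v w0.
have hg1 : 0 <= be * la * a1 * (dot D u - g1) by rewrite mulr_ge0 ?subr_ge0// mulr_ge0.
have hg2 : 0 <= be * la * b1 * (dot v u - (g1 - g0)) by rewrite mulr_ge0 ?subr_ge0// mulr_ge0.
have hA : 0 <= - (A * a1 * dot D D).
  by rewrite -mulNr mulr_ge0 ?dot_ge0// -mulNr mulr_ge0// oppr_ge0.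
(* Completing this square bounds the Tikhonov product [- 2 <z + D, D>] by [2^-1 |z|^2]. *)
have hz : 0 <= be * cc * a1 * dot (z + 2 *: D) (z + 2 *: D).
  by rewrite mulr_ge0 ?dot_ge0.
pose Y := A *: D + B *: v - (be * cc) *: x.
have hY : dot Y Y <= 3 * (A ^+ 2 * dot D D + B ^+ 2 * dot v v)
    + 9 * (be * cc) ^+ 2 * (dot z z + dot D D + dot v v).
  have := dot_triangle3 (A *: D) (B *: v) ((be * cc) *: x).
  have : (be * cc) ^+ 2 * dot x x <= (be * cc) ^+ 2 * (3 * (dot z z + dot D D + dot v v)).
    by rewrite ler_wpM2l ?sqr_ge0// dot_triangle3.
  rewrite -/Y !dotZl !dotZr; lra.
have hD := dot_sub_ge Y ((be * la) *: u).
have e1 : dot W1 W1 = dot W0 W0 + 2 * dot (Y - (be * la) *: u) W1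
   - dot (Y - (be * la) *: u) (Y - (be * la) *: u).
  rewrite /W0 /W1 /Y /x /A /B !dotE.
  rewrite ?(dotC dot v D) ?(dotC dot u D) ?(dotC dot z D) ?(dotC dot u v).
  rewrite ?(dotC dot z v) ?(dotC dot u z).
  ring.
have hD2 : - dot (Y - (be * la) *: u) (Y - (be * la) *: u) <=
   3 * (A ^+ 2 * dot D D + B ^+ 2 * dot v v)
    + 9 * (be * cc) ^+ 2 * (dot z z + dot D D + dot v v) - 2^-1 * (be * la) ^+ 2 * dot u u.
  by move: hD; rewrite [dot (_ *: u) (_ *: u)]dotZl dotZr; lra.
rewrite e1; move: hD2; move: (dot W0 W0) (- dot (Y - _) (Y - _)) => w1 w2 hD2.
move: (e3 ^+ 2 / w) (e2 ^+ 2 / w) yD yz => k3 k2 yD yz.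
clear e1 hY hD.
move: hz yD yz hA hD2 hg1 hg2; rewrite /Y /W1 /x /e3 /e2 /A /B !dotE.
rewrite ?(dotC dot v D) ?(dotC dot u D) ?(dotC dot z D) ?(dotC dot u v).
rewrite ?(dotC dot z v) ?(dotC dot u z).
clear; move: (dot D D) (dot v v) (dot z z) (dot u u) (dot D v) (dot D z).
move: (dot v z) (dot D u) (dot v u) => vz Du vu DD vv zz uu Dv Dz.
move=> hz yD yz hA hD2 hg1 hg2.
lra.
Qed.
End EnergyStep.

(** * Series with bounded partial sums *)

Section Series.
Context {R : realType}.
Implicit Types (h A E eps d : nat -> R).

(** A discrete integral comparison: write [t / (t + 1) = 1 - (t + 1)^-1], then use
    [ln (1 - y) <= - y] and [expR y >= 1 + y]. *)
Lemma powR_telescope (t r : R) : 0 < t -> 0 <= r ->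
  r * (t + 1) `^ (-1 - r) <= t `^ (- r) - (t + 1) `^ (- r).
Proof.
move=> t0 r0; have t10 : 0 < t + 1 by rewrite addr_gt0.
have i0 : 0 < (t + 1)^-1 by rewrite invr_gt0.
rewrite (powR_add (-1) (- r) t10) powR_inv1 ?(ltW t10)// lerBrDr.
have -> : t `^ (- r) = (t + 1) `^ (- r) * (t / (t + 1)) `^ (- r).
  by rewrite -powRM ?divr_ge0 ?(ltW t0) ?(ltW t10)// mulrCA divff ?mulr1// gt_eqF.
have -> : t / (t + 1) = 1 + - (t + 1)^-1 by field; rewrite gt_eqF.
have i1 : (t + 1)^-1 < 1 by rewrite invf_lt1// ltrDr.
have -> (P : R) : r * ((t + 1)^-1 * P) + P = P * (1 + r * (t + 1)^-1) by ring.
rewrite ler_pM2l ?powR_gt0// /powR gt_eqF ?subr_gt0//.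
apply: le_trans (expR_ge1Dx _); rewrite lerD2l mulNr -mulrN ler_wpM2l// lerNr.
by rewrite le_ln1Dx// ltrN2.
Qed.

(** The free starting index makes finitely many terms irrelevant, in particular the initial indices
    where [f (x k)] may be infinite. *)
Definition bounded_sums h := exists N : nat, exists M : R,
  forall m, \sum_(N <= k < m) h k <= M.

Lemma bounded_sums_powR (r : R) : 0 < r ->
  bounded_sums (fun k => k%:R `^ (-1 - r)).
Proof.
move=> r0; exists 1%N, (1 + r^-1) => m.
have aux k : \sum_(1 <= i < k.+2) i%:R `^ (-1 - r) <= 1 + r^-1 - r^-1 * k.+1%:R `^ (- r).
  elim: k => [|k IH]; first by rewrite big_nat1 !powR1 mulr1 addrK.
  rewrite big_nat_recr//=.
  have k0 : 0 < k.+1%:R :> R by rewrite ltr0n.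
  have := powR_telescope k0 (ltW r0); rewrite natr1 -(ler_pM2l (_ : 0 < r^-1)) ?invr_gt0//.
  rewrite mulKf ?gt_eqF//; move: IH; lra.
have r10 : 0 <= r^-1 by rewrite invr_ge0 ltW.
case: m => [|[|m]]; [by rewrite big_geq// addr_ge0|by rewrite big_geq// addr_ge0|].
have := aux m; have := mulr_ge0 r10 (powR_ge0 m.+1%:R (- r)); lra.
Qed.

Lemma bounded_sums_tail h : bounded_sums h ->
  \forall N \near \oo, exists M : R, forall n, \sum_(N <= k < n) h k <= M.
Proof.
move=> [N [M hM]]; exists N => // m /= Nm.
have bnd n : (m <= n)%N -> \sum_(m <= k < n) h k <= M - \sum_(N <= k < m) h k.
  by move=> mn; rewrite lerBrDl -big_cat_nat.
exists (M - \sum_(N <= k < m) h k) => n.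
have [|/ltnW nm] := leqP m n; first exact: bnd.
by apply: le_trans (bnd _ (leqnn _)); rewrite !big_geq.
Qed.

Lemma bounded_sums_le h h' (C : R) : 0 <= C ->
  (\forall k \near \oo, h' k <= C * h k) -> bounded_sums h -> bounded_sums h'.
Proof.
move=> C0 [m _ hm] /bounded_sums_tail hh; near \oo => N.
have [M hM] : exists M : R, forall n, \sum_(N <= k < n) h k <= M by near: N.
have mN : (m <= N)%N by near: N; exact: nbhs_infty_ge.
exists N, (C * M) => n; apply: (@le_trans _ _ (C * \sum_(N <= k < n) h k)).
  rewrite mulr_sumr; apply: ler_sum_nat => k /andP[Nk _].
  by apply: hm; exact: leq_trans Nk.
by rewrite ler_wpM2l.
Unshelve. all: by end_near. Qed.

Lemma bounded_sums_shift h : bounded_sums (fun k => h k.+1) -> bounded_sums h.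
Proof.
move=> [N [M hM]]; exists N.+1, M => -[|n]; last by rewrite big_add1.
by have := hM 0%N; rewrite !big_geq.
Qed.

Lemma bounded_sumsD h h' : bounded_sums h -> bounded_sums h' ->
  bounded_sums (fun k => h k + h' k).
Proof.
move=> /bounded_sums_tail hh /bounded_sums_tail hh'; near \oo => N.
have [M hM] : exists M : R, forall n, \sum_(N <= k < n) h k <= M by near: N.
have [M' hM'] : exists M : R, forall n, \sum_(N <= k < n) h' k <= M by near: N.
by exists N, (M + M') => n; rewrite big_split/= lerD.
Unshelve. all: by end_near. Qed.

Lemma bounded_sumsZ h (C : R) : 0 <= C -> bounded_sums h ->
  bounded_sums (fun k => C * h k).
Proof.
by move=> C0 [N [M hM]]; exists N, (C * M) => n; rewrite -mulr_sumr ler_wpM2l.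
Qed.

Lemma bounded_sums_cvg0 h : (forall k, 0 <= h k) -> bounded_sums h ->
  h k @[k --> \oo] --> (0 : R).
Proof.
move=> h0 [N [M hM]]; apply: cvg_series_cvg_0.
apply: nondecreasing_is_cvgn.
  by apply/nondecreasing_seqP => n; rewrite !seriesEnat/= big_nat_recr//= lerDl.
exists (\sum_(0 <= k < N) h k + M) => _ [n _ <-]; rewrite seriesEnat/=.
have S0 (i j : nat) : 0 <= \sum_(i <= k < j) h k by rewrite sumr_ge0.
have [Nn|/ltnW nN] := leqP N n.
  by rewrite (big_cat_nat (n := N))//= lerD2l.
rewrite [X in _ <= X + _](big_cat_nat (n := n))//= -addrA lerDl addr_ge0//.
by have := hM 0%N; rewrite big_geq.
Qed.

Lemma bounded_sums_eseries h (F : nat -> \bar R) (m : nat) :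
  (forall k, (m <= k)%N -> 0 <= h k /\ F k = (h k)%:E) ->
  bounded_sums h -> (\sum_(m <= k <oo) F k < +oo)%E.
Proof.
move=> hF /bounded_sums_tail hh; near \oo => N.
have [M hM] : exists M : R, forall n, \sum_(N <= k < n) h k <= M by near: N.
have mN : (m <= N)%N by near: N; exact: nbhs_infty_ge.
apply: (@le_lt_trans _ _ (\sum_(m <= k < N) h k + M)%:E); last exact: ltry.
apply: lime_le.
  by apply: is_cvg_nneseries => k mk _; have [h0 ->] := hF _ mk; rewrite lee_fin.
near=> n; have Nn : (N <= n)%N by near: n; exact: nbhs_infty_ge.
rewrite (eq_big_nat _ _ (F2 := fun k => (h k)%:E)); last first.
  by move=> k /andP[/hF[]].
by rewrite sumEFin lee_fin (big_cat_nat (n := N))//= lerD2l.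
Unshelve. all: by end_near. Qed.

(* [E n] and the partial sums of [A] are both controlled
   by [expR (sum of eps) * (E N + sum of d)]. *)
Lemma discrete_gronwall E A eps d : bounded_sums eps -> bounded_sums d ->
  (\forall k \near \oo, [/\ 0 <= E k, 0 <= A k, 0 <= eps k, 0 <= d k &
     E k.+1 + A k <= (1 + eps k) * E k + d k]) ->
  (exists M : R, \forall k \near \oo, E k <= M) /\ bounded_sums A.
Proof.
move=> /bounded_sums_tail heps /bounded_sums_tail hd [m _ hm]; near \oo => N.
have [Me hMe] : exists M : R, forall n, \sum_(N <= k < n) eps k <= M by near: N.
have [Md hMd] : exists M : R, forall n, \sum_(N <= k < n) d k <= M by near: N.
have mN : (m <= N)%N by near: N; exact: nbhs_infty_ge.
have {}hm k : (N <= k)%N -> [/\ 0 <= E k, 0 <= A k, 0 <= eps k, 0 <= d k &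
    E k.+1 + A k <= (1 + eps k) * E k + d k].
  by move=> Nk; apply: hm; exact: leq_trans Nk.
have key j : E (N + j)%N + \sum_(N <= k < N + j) A k <=
    expR (\sum_(N <= k < N + j) eps k) * (E N + \sum_(N <= k < N + j) d k).
  elim: j => [|j IH]; first by rewrite addn0 !big_geq// expR0 mul1r !addr0.
  have [E0 A0 e0 d0 hE] := hm _ (leq_addr j N).
  have NNj : (N <= N + j)%N by exact: leq_addr.
  rewrite addnS !big_nat_recr//= expRD.
  have SA0 : 0 <= \sum_(N <= k < N + j) A k.
    by rewrite big_nat sumr_ge0// => k /andP[/hm[]].
  have Se0 : 0 <= \sum_(N <= k < N + j) eps k.
    by rewrite big_nat sumr_ge0// => k /andP[/hm[]].
  move: IH SA0 Se0.
  move: (\sum_(N <= k < N + j) A k) (\sum_(N <= k < N + j) eps k) (\sum_(N <= k < N + j) d k).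
  move=> SA Se Sd IH SA0 Se0.
  have x1 : 1 <= expR Se by rewrite -expR0 ler_expR.
  have x2 : 1 + eps (N + j)%N <= expR (eps (N + j)%N) by exact: expR_ge1Dx.
  have X0 : 0 <= E (N + j)%N + SA by rewrite addr_ge0.
  have := ler_pM (addr_ge0 ler01 e0) X0 x2 IH.
  have x3 : 1 <= expR Se * expR (eps (N + j)%N).
    by rewrite -expRD -expR0 ler_expR addr_ge0.
  have := ler_wpM2r d0 x3; have := mulr_ge0 e0 SA0; rewrite mul1r.
  move: hE; lra.
have bnd j : E (N + j)%N + \sum_(N <= k < N + j) A k <= expR Me * (E N + Md).
  apply: (le_trans (key j)); apply: ler_pM; rewrite ?expR_ge0 ?ler_expR ?lerD2l//.
  have [E0 _ _ _ _] := hm _ (leqnn N).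
  by rewrite addr_ge0// big_nat sumr_ge0// => k /andP[/hm[]].
have SA0 j : 0 <= \sum_(N <= k < j) A k.
  by rewrite big_nat sumr_ge0// => k /andP[/hm[]].
split.
  exists (expR Me * (E N + Md)); exists N => // k /= Nk.
  by have := bnd (k - N)%N; rewrite subnKC//; have := SA0 k; lra.
exists N, (expR Me * (E N + Md)) => n.
have [Nn|nN] := leqP N n.
  have := bnd (n - N)%N; rewrite subnKC//; have [] := hm _ Nn; lra.
rewrite big_geq ?(ltnW nN)//; have := bnd 0%N; rewrite addn0 big_geq// addr0.
by have [] := hm _ (leqnn N); lra.
Unshelve. all: by end_near. Qed.

End Series.

Lemma near_natr {R : realType} (P : set R) :
  (\forall t \near +oo, P t) -> \forall k \near \oo, P k%:R.
Proof. by move=> hP; exact: cvgr_idn hP. Qed.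

(** * Decrease of the energy along the iterates *)

Section Energy.
Context {R : realType} {H : completeNormedModType R}.
Variable dot : {dot H for idfun}.
Hypothesis Hdot : induces_norm dot.
Variables (al c q p lam de a n rho : R).
Hypotheses (al_gt0 : 0 < al) (c_gt0 : 0 < c) (q_gt0 : 0 < q) (q_le1 : q <= 1).
Hypotheses (qp : q + 1 <= p) (lam_gt0 : 0 < lam) (de_ge0 : 0 <= de).
Hypotheses (rho_gt0 : 0 < rho) (rho_le_q : rho <= q).
Hypothesis a_gt : q + 1 + de < a.
Hypothesis n_spec : [/\ q < 1, n = a * al & rho <= 1 - q] \/
  [/\ q = 1, a < al - 1 & n = a * (al - a - 1)].
Variables (x u : nat -> H) (z : H) (g : nat -> R).
Hypothesis g_ge0 : forall k, (2 <= k)%N -> 0 <= g k.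
Hypothesis g_le : forall k, (2 <= k)%N -> g k <= dot (x k - z) (u k).
Hypothesis g_diff : forall k, (2 <= k)%N ->
  g k.+1 - g k <= dot (x k.+1 - x k) (u k.+1).
Hypothesis x_rec : forall k, (1 <= k)%N ->
  x k.+1 - x k + (lam * k%:R `^ de) *: u k.+1 + (c / k%:R `^ p) *: x k
  = (1 - al / k%:R `^ q) *: (x k - x k.-1).

Let s : R := (q + 1) / 2.
Let V (k : nat) : H := x k - x k.-1.
Let D (k : nat) : H := x k - z.
Let W (k : nat) : H := wa q a k%:R *: D k + wb al q k%:R *: V k.

(** In the notation of [energy_step] the value weight is [2 (be la) b1] with [be = k ^ s] and
    [b1 = wb (k + 1)]. It matches the coefficient of [g0] there exactly, leaving only the drift
    bounded in [near_value_weight]. *)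
Definition energy (k : nat) : R :=
  2 * lam * (k%:R `^ (s + de) * wb al q (k%:R + 1)) * g k
  + dot (W k) (W k) + n * dot (D k) (D k) + sig c q p k%:R * dot (x k) (x k).

Let n_gt0 : 0 < n.
Proof.
have a0 : 0 < a by move: a_gt q_gt0 de_ge0; lra.
case: n_spec => [[_ -> _]|[_ h ->]]; first by rewrite mulr_gt0.
by rewrite mulr_gt0//; move: h; lra.
Qed.

Lemma dot_add_le (y y' : H) : dot (y + y') (y + y') <= 2 * dot y y + 2 * dot y' y'.
Proof. by have := dot_ge0 Hdot (y - y'); rewrite !dotE (dotC dot y' y); lra. Qed.

(** The velocity is recovered from [wb V = W - wa D]: with [wb >= t ^ s / 2] and [wa <= a] this
    gives [t ^ (q + 1) |V|^2 <= 8 |W|^2 + 8 a^2 |D|^2], whence the constant. *)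
Lemma near_energy_ge : \forall k \near \oo,
  [/\ 0 <= energy k, n * dot (D k) (D k) <= energy k,
      lam * (k%:R `^ (q + 1 + de) * g k) <= energy k
    & k%:R `^ (q + 1) * dot (V k) (V k) <= (8 + 8 * a ^+ 2 / n) * energy k].
Proof.
have hb0 := near_natr (near_wb_ge al_gt0 q_gt0).
have hb1 := near_natr (near_wb_succ_ge al_gt0 q_gt0).
near=> k; pose t : R := k%:R.
have k2 : (2 <= k)%N by near: k; exact: nbhs_infty_ge.
have t1 : 1 <= t by rewrite ler1n (leq_trans _ k2).
have t0 : 0 < t by rewrite (lt_le_trans _ t1).
have b0 : t `^ s / 2 <= wb al q t by rewrite /t; near: k.
have b1 : t `^ s / 2 <= wb al q (t + 1) by rewrite /t; near: k.
have ts0 : 0 < t `^ s by rewrite powR_gt0.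
have gk := g_ge0 k2.
have e1 : t `^ (q + 1 + de) = t `^ (s + de) * t `^ s.
  by rewrite -powR_add//; congr (_ `^ _); rewrite /s; lra.
have e2 : t `^ (q + 1) = t `^ s * t `^ s.
  by rewrite -powR_add//; congr (_ `^ _); rewrite /s; lra.
have val : lam * (t `^ (q + 1 + de) * g k) <=
    2 * lam * (t `^ (s + de) * wb al q (t + 1)) * g k.
  have : 0 <= lam * t `^ (s + de) * g k by rewrite !mulr_ge0 ?powR_ge0// ltW.
  move=> /ler_wpM2l/(_ _ _ b1); rewrite e1; lra.
have val0 : 0 <= lam * (t `^ (q + 1 + de) * g k).
  by rewrite !mulr_ge0 ?powR_ge0// ltW.
have W0 := dot_ge0 Hdot (W k).
have D0 : 0 <= n * dot (D k) (D k) by rewrite mulr_ge0 ?(dot_ge0 Hdot)// ltW.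
have X0 : 0 <= sig c q p t * dot (x k) (x k).
  by rewrite mulr_ge0 ?(dot_ge0 Hdot)// mulr_ge0 ?powR_ge0// ltW.
have eE : lam * (t `^ (q + 1 + de) * g k) + dot (W k) (W k) + n * dot (D k) (D k)
    <= energy k.
  by rewrite /energy -/t; lra.
split; rewrite -/t; [lra|lra|lra|].
have a_gt0 : 0 < a by move: a_gt q_gt0 de_ge0; lra.
have wa0 : 0 <= wa q a t by exact: (wa_ge0 q_gt0 de_ge0 a_gt).
have wa_le : wa q a t <= a.
  rewrite /wa -[leRHS]mulr1 ler_pM2l// powR_le1//; move: q_le1; lra.
have eV : wb al q t *: V k = W k + (- wa q a t) *: D k.
  by rewrite /W addrAC scaleNr subrr add0r.
have hV : wb al q t ^+ 2 * dot (V k) (V k)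
    <= 2 * dot (W k) (W k) + 2 * (wa q a t ^+ 2 * dot (D k) (D k)).
  have := dot_add_le (W k) ((- wa q a t) *: D k).
  by rewrite -eV !dotZl !dotZr; lra.
have wa2 : wa q a t ^+ 2 <= a ^+ 2 by rewrite ler_pXn2r ?nnegrE// ltW.
have hD : wa q a t ^+ 2 * dot (D k) (D k) <= a ^+ 2 / n * (n * dot (D k) (D k)).
  rewrite mulrA divfK ?gt_eqF//; apply: ler_wpM2r => //; exact: dot_ge0.
have hb : t `^ s * t `^ s / 4 <= wb al q t ^+ 2.
  have : (t `^ s / 2) ^+ 2 <= wb al q t ^+ 2.
    rewrite ler_pXn2r ?nnegrE// ?divr_ge0 ?(ltW ts0)//.
    by apply: le_trans b0; rewrite divr_ge0// ltW.
  by rewrite !expr2; lra.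
have VV := dot_ge0 Hdot (V k).
have := ler_wpM2r VV hb; rewrite e2.
have aa : 0 <= a ^+ 2 / n by rewrite divr_ge0 ?sqr_ge0// ltW.
have k1 : n * dot (D k) (D k) <= energy k by lra.
have := ler_wpM2l aa k1.
lra.
Unshelve. all: by end_near. Qed.

Lemma near_energy_decr : exists Kg kap C : R, [/\ 0 < Kg, 0 < kap, 0 <= C &
  \forall k \near \oo,
  energy k.+1 + (Kg * (k%:R `^ (q + de) * g k.+1)
    + kap * (k%:R * dot (V k.+1) (V k.+1))
    + 2^-1 * lam ^+ 2 * (k%:R `^ (q + 1 + 2 * de) * dot (u k.+1) (u k.+1)))
  <= (1 + C * k%:R `^ (-1 - rho)) * energy k
     + C * (k%:R `^ (q - p) + k%:R `^ (-1 - rho))].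
Proof.
have [Kg Kg0 hval] := near_value_weight al_gt0 q_gt0 q_le1 de_ge0 a_gt.
have [kap [C [kap0 C0 hcoef]]] := near_step_coefficients al_gt0 c_gt0 q_gt0
  q_le1 qp de_ge0 rho_gt0 rho_le_q a_gt n_spec.
have ZZ := dot_ge0 Hdot z.
have Cn0 : 0 <= 2 * C / n by rewrite divr_ge0 ?mulr_ge0// ltW.
have CZ0 : 0 <= C * dot z z by rewrite mulr_ge0.
(* [kap / 2] is what [absorb_velocity] leaves. The last constant adds the multiplicative error
   [2 C / n] and the source [C |z|^2], so that it serves in both places. *)
exists (2 * lam * Kg), (kap / 2), (2 * C / n + C * dot z z); split.
- by rewrite !mulr_gt0.
- by rewrite divr_gt0.
- by rewrite addr_ge0.
have hE : \forall k \near \oo, 0 <= energy k /\ n * dot (D k) (D k) <= energy k.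
  by apply: filterS near_energy_ge => k [].
have {}hval := near_natr hval; have {}hcoef := near_natr hcoef.
have hb1 := near_natr (near_wb_succ_ge al_gt0 q_gt0).
near=> k; pose t : R := k%:R; rewrite -/t.
have k2 : (2 <= k)%N by near: k; exact: nbhs_infty_ge.
have k1 : (1 <= k)%N by exact: ltnW.
have t1 : 1 <= t by rewrite ler1n.
have t0 : 0 < t by rewrite (lt_le_trans _ t1).
have tS : k.+1%:R = t + 1 by rewrite -natr1.
have hv : (t + 1) `^ (s + de) * wb al q (t + 1 + 1)
    - t `^ (s + de) * (wb al q (t + 1) + wa q a (t + 1)) <= - (Kg * t `^ (q + de)).
  by rewrite /t; near: k.
have b1 : t `^ s / 2 <= wb al q (t + 1) by rewrite /t; near: k.
have [c1 c2 c3] : [/\ (2 * (wB al q a t * wb al q (t + 1)) - n + sig c q p t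
      + 2 * (kap * t) - 2 * err_x al c q p t + 3 * wB al q a t ^+ 2
      + 9 * tik c q p t ^+ 2 <= - (kap * t))%R,
    err_D al c q p a n t ^+ 2 / (kap * t) + 3 * wA q a t ^+ 2 + 9 * tik c q p t ^+ 2
      <= C * t `^ (-1 - rho)
  & 2^-1 * (tik c q p t * wa q a (t + 1)) + err_x al c q p t ^+ 2 / (kap * t)
      + 9 * tik c q p t ^+ 2 <= C * (t `^ (q - p) + t `^ (-1 - rho))].
  by rewrite /t; near: k.
have big : 4 * C / kap <= t.
  rewrite /t; near: k.
  exact: (near_natr (nbhs_pinfty_ge (num_real (4 * C / kap)))).
have [E0 En] : 0 <= energy k /\ n * dot (D k) (D k) <= energy k by near: k.
have gk := g_ge0 k2; have gk1 := g_ge0 (leqW k2).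
have ts0 : 0 < t `^ s by rewrite powR_gt0.
have a_gt0 : 0 < a by move: a_gt q_gt0 de_ge0; lra.
have eV : x k.+1 - x k = V k.+1 by [].
have eD : D k.+1 - V k.+1 = D k by rewrite /D /V /= opprB addrCA addrAC subrr add0r.
have ex1 : z + D k.+1 = x k.+1 by rewrite /D addrC subrK.
have ex : z + D k.+1 - V k.+1 = x k by rewrite ex1 /V /= opprB addrC subrK.
have bt0 : 0 <= t `^ s * (lam * t `^ de) by rewrite !mulr_ge0 ?powR_ge0// ltW.
have a10 : 0 <= wa q a (t + 1) by exact: (wa_ge0 q_gt0 de_ge0 a_gt).
have b10 : 0 <= wb al q (t + 1) by apply: le_trans b1; rewrite divr_ge0// ltW.
have A0 : wa q a (t + 1) - wa q a t <= 0 by exact: (wA_le0 q_gt0 q_le1 de_ge0 a_gt t0).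
have w0 : 0 < kap * t by rewrite mulr_gt0.
have bca : 0 <= t `^ s * (c / t `^ p) * wa q a (t + 1).
  by rewrite !mulr_ge0 ?powR_ge0 ?invr_ge0 ?powR_ge0// ltW.
have := energy_step Hdot z n (sig c q p t) w0 bt0 a10 b10 A0 bca (g_le (leqW k2)) (g_diff k2).
rewrite -/(D k.+1) eV eD ex ex1.
rewrite -/(wA q a t) -/(tik c q p t) -/(wB al q a t) -/(err_x al c q p t) -/(err_D al c q p a n t).
(* By the recursion the bracket is [(1 - al / t ^ q) V_k], and multiplying by [t ^ s] gives
   [wb t]. *)
have -> : wa q a t *: D k + t `^ s *: (V k.+1 + (lam * t `^ de) *: u k.+1 + (c / t `^ p) *: x k)
    = W k.
  rewrite -eV x_rec// scalerA /W; congr (_ + _ *: _).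
  by rewrite /wb powR_add// powRN -/t; ring.
have -> : wa q a (t + 1) *: D k.+1 + wb al q (t + 1) *: V k.+1 = W k.+1 by rewrite /W tS.
have -> : t `^ s * (lam * t `^ de) = lam * t `^ (s + de) by rewrite powR_add//; ring.
have -> : (lam * t `^ (s + de)) ^+ 2 = lam ^+ 2 * t `^ (q + 1 + 2 * de).
  rewrite exprMn [_ `^ _ ^+ 2]expr2 -powR_add//; congr (_ * _ `^ _); rewrite /s; lra.
move=> hstep.
have VV := dot_ge0 Hdot (V k.+1); have DD := dot_ge0 Hdot (D k.+1).
have DD0 := dot_ge0 Hdot (D k).
have XX := dot_ge0 Hdot (x k.+1).
have sg_le : sig c q p (t + 1) * dot (x k.+1) (x k.+1) <= sig c q p t * dot (x k.+1) (x k.+1).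
  by rewrite ler_wpM2r// ler_pM2l// powR_succ_le// subr_le0.
have val_le := ler_wpM2r (mulr_ge0 (ltW lam_gt0) gk1) hv.
have vv_le := ler_wpM2r VV c1.
have dd_le := ler_wpM2r DD c2.
have zz_le := ler_wpM2r ZZ c3.
have r0 : 0 < t `^ (-1 - rho) by rewrite powR_gt0.
have r1 : t `^ (-1 - rho) <= 1.
  by rewrite powR_le1// subr_le0 (le_trans _ (ltW rho_gt0))// lerN10.
have pq0 : 0 < t `^ (q - p) by rewrite powR_gt0.
have DD_le : dot (D k.+1) (D k.+1) <= 2 * dot (D k) (D k) + 2 * dot (V k.+1) (V k.+1).
  have -> : D k.+1 = D k + V k.+1 by rewrite -eD subrK.
  exact: dot_add_le.
have dd_le2 : C * t `^ (-1 - rho) * dot (D k.+1) (D k.+1) <=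
    2 * C / n * t `^ (-1 - rho) * energy k + kap / 2 * (t * dot (V k.+1) (V k.+1)).
  apply: absorb_velocity big VV DD_le En => //.
  by rewrite (ltW r0).
have src : C * (t `^ (q - p) + t `^ (-1 - rho)) * dot z z <=
    (2 * C / n + C * dot z z) * (t `^ (q - p) + t `^ (-1 - rho)).
  have : 0 <= 2 * C / n * (t `^ (q - p) + t `^ (-1 - rho)).
    by rewrite mulr_ge0// addr_ge0// ltW.
  lra.
have mul0 : 0 <= C * dot z z * t `^ (-1 - rho) * energy k.
  by rewrite !mulr_ge0// ltW.
have eE1 : energy k.+1 = 2 * lam * ((t + 1) `^ (s + de) * wb al q (t + 1 + 1)) * g k.+1
  + dot (W k.+1) (W k.+1) + n * dot (D k.+1) (D k.+1)
  + sig c q p (t + 1) * dot (x k.+1) (x k.+1) by rewrite /energy tS.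
have eE0 : energy k = 2 * lam * (t `^ (s + de) * wb al q (t + 1)) * g k
  + dot (W k) (W k) + n * dot (D k) (D k) + sig c q p t * dot (x k) (x k) by [].
move: hstep sg_le val_le vv_le dd_le zz_le dd_le2 src mul0 eE1 eE0.
move: (energy k.+1) (energy k) (dot (W k.+1) (W k.+1)) (dot (W k) (W k)).
move: (dot (D k.+1) (D k.+1)) (dot (D k) (D k)) (dot (V k.+1) (V k.+1)) (dot (u k.+1) (u k.+1)).
move: (dot (x k.+1) (x k.+1)) (dot (x k) (x k)) (dot z z).
clear; move=> *; lra.
Unshelve. all: by end_near. Qed.
End Energy.

(** * Rates *)

Section SeriesPowers.
Context {R : realType}.

Lemma near_powR_succ_le2 (e : R) : \forall t \near +oo, (t + 1) `^ e <= 2 * t `^ e.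
Proof.
have [e0|/ltW e0] := leP 0 e; first exact: (near_powR_succ_le e0 ltr01).
near=> t; have t0 : 0 < t by near: t; apply: nbhs_pinfty_gt; exact: num_real.
apply: (le_trans (powR_succ_le t0 e0)).
by rewrite ler_peMl ?powR_ge0// ler1n.
Unshelve. all: by end_near. Qed.

(** The dissipation at step [k] carries [h k.+1] with weight [k ^ e]; moving the weight to [k + 1]
    costs a factor 2. *)
Lemma bounded_sums_succ_powR (e K : R) (h A : nat -> R) : 0 < K ->
  (\forall k \near \oo, 0 <= h k.+1 /\ K * (k%:R `^ e * h k.+1) <= A k) ->
  bounded_sums A -> bounded_sums (fun k => k%:R `^ e * h k).
Proof.
move=> K0 hA bA; apply: bounded_sums_shift.
have h2 := near_natr (near_powR_succ_le2 e).
apply: (bounded_sums_le (C := 2 / K)) bA; first by rewrite divr_ge0// ltW.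
near=> k.
have [h0 hk] : 0 <= h k.+1 /\ K * (k%:R `^ e * h k.+1) <= A k by near: k.
have : (k%:R + 1) `^ e <= 2 * k%:R `^ e by near: k.
move=> /(ler_wpM2r h0); rewrite natr1 => /le_trans; apply.
have K2 : 0 <= 2 / K by rewrite divr_ge0// ltW.
apply: le_trans (ler_wpM2l K2 hk).
have -> (y : R) : 2 / K * (K * y) = 2 * y by field; rewrite gt_eqF.
by rewrite mulrA.
Unshelve. all: by end_near. Qed.

Lemma bigO_powR (h : nat -> R) (e M : R) :
  (\forall k \near \oo, 0 <= h k <= M * k%:R `^ e) -> h =O_\oo (fun k => k%:R `^ e).
Proof.
move=> hM; apply/eqO_exP; exists (`|M| + 1); first by rewrite ltr_wpDl.
apply: filterS hM => k /andP[h0 hk]; rewrite (ger0_norm h0) (ger0_norm (powR_ge0 _ _)).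
suff : M * k%:R `^ e <= (`|M| + 1) * k%:R `^ e by exact: le_trans hk.
rewrite ler_wpM2r ?powR_ge0//.
by rewrite (le_trans (ler_norm _))// lerDl.
Qed.

Lemma littleo_powR (h : nat -> R) (e e' M : R) : e' < e ->
  (\forall k \near \oo, 0 <= h k <= M * k%:R `^ e') -> h =o_\oo (fun k => k%:R `^ e).
Proof.
move=> ee hM; apply/eqoP => eps eps0.
have small : \forall t \near +oo, t `^ (- (e - e')) <= eps / (`|M| + 1).
  by apply: near_powRN; rewrite ?subr_gt0// divr_gt0// ltr_wpDl.
have {}small := near_natr small.
near=> k.
have /andP[h0 hk] : 0 <= h k <= M * k%:R `^ e' by near: k.
have k0 : 0 < k%:R :> R by rewrite ltr0n; near: k; exact: nbhs_infty_gt.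
have : k%:R `^ (- (e - e')) <= eps / (`|M| + 1) by near: k.
rewrite ler_pdivlMr ?ltr_wpDl// => hs.
rewrite (ger0_norm h0) (ger0_norm (powR_ge0 _ _)).
suff : M * k%:R `^ e' <= eps * k%:R `^ e by exact: le_trans hk.
have -> : e' = - (e - e') + e by lra.
rewrite (powR_add _ e k0) mulrA ler_wpM2r ?powR_ge0//; apply: le_trans hs.
by rewrite mulrC ler_wpM2l ?powR_ge0// (le_trans (ler_norm _))// lerDl.
Unshelve. all: by end_near. Qed.

(** For nonnegative [y] and [N], [y ^ 2 <= N] gives [y <= N + 1], which avoids square roots in the
    constants. *)
Lemma sqr_le_powR (h t e M : R) : 0 < t -> 0 <= h ->
  t `^ (2 * e) * h ^+ 2 <= M -> h <= (`|M| + 1) * t `^ (- e).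
Proof.
move=> t0 h0 hM.
have te : 0 < t `^ e by rewrite powR_gt0.
rewrite powRN ler_pdivlMr//.
have sq : (h * t `^ e) ^+ 2 <= `|M|.
  apply: le_trans (ler_norm M); apply: le_trans hM.
  have -> : 2 * e = e + e by lra.
  by rewrite powR_add// exprMn mulrC expr2.
have y0 : 0 <= h * t `^ e by rewrite mulr_ge0// ltW.
have M0 := normr_ge0 M.
move: sq y0 M0; move: (h * t `^ e) `|M| => y N; rewrite expr2; nra.
Qed.

(** The general term of the series tends to 0, hence so does its square root [k ^ e h k]. *)
Lemma littleo_bounded_sums (h : nat -> R) (e : R) : (forall k, 0 <= h k) ->
  bounded_sums (fun k => k%:R `^ (2 * e) * h k ^+ 2) -> h =o_\oo (fun k => k%:R `^ (- e)).
Proof.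
move=> h0 hs; apply/eqoP => /= eps eps0.
have eps2 : 0 < eps ^+ 2 by rewrite exprn_gt0.
have c0 : k%:R `^ (2 * e) * h k ^+ 2 @[k --> \oo] --> (0 : R).
  by apply: bounded_sums_cvg0 => // k; rewrite mulr_ge0 ?powR_ge0 ?sqr_ge0.
have lt_eps : \forall k \near \oo, k%:R `^ (2 * e) * h k ^+ 2 < eps ^+ 2.
  exact: (cvgr_lt _ c0).
near=> k.
have k0 : 0 < k%:R :> R by rewrite ltr0n; near: k; exact: nbhs_infty_gt.
have hk : k%:R `^ (2 * e) * h k ^+ 2 < eps ^+ 2 by near: k.
have te : 0 < (k%:R : R) `^ e by rewrite powR_gt0.
rewrite (ger0_norm (h0 k)) (ger0_norm (powR_ge0 _ _)).
suff : h k <= eps * k%:R `^ (- e) by [].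
rewrite powRN ler_pdivlMr//.
rewrite -(ler_pXn2r (n := 2)) ?nnegrE// ?(ltW eps0)//; last by rewrite mulr_ge0// ltW.
apply: ltW; apply: le_lt_trans hk.
have -> : 2 * e = e + e by lra.
by rewrite powR_add// exprMn mulrC expr2.
Unshelve. all: by end_near. Qed.

End SeriesPowers.

(** * Weighted bounds for an abstract inertial sequence *)

Section Rates.
Context {R : realType} {H : completeNormedModType R}.
Variable dot : {dot H for idfun}.
Hypothesis Hdot : induces_norm dot.
Variables (al c q p lam de : R).
Hypotheses (al_gt0 : 0 < al) (c_gt0 : 0 < c) (q_gt0 : 0 < q) (q_le1 : q <= 1).
Hypotheses (qp : q + 1 <= p) (lam_gt0 : 0 < lam) (de_ge0 : 0 <= de).
Hypothesis al_case : q < 1 \/ q = 1 /\ de < al - 3.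
Variables (x u : nat -> H) (z : H) (g : nat -> R).
Hypothesis g_ge0 : forall k, (2 <= k)%N -> 0 <= g k.
Hypothesis g_le : forall k, (2 <= k)%N -> g k <= dot (x k - z) (u k).
Hypothesis g_diff : forall k, (2 <= k)%N ->
  g k.+1 - g k <= dot (x k.+1 - x k) (u k.+1).
Hypothesis x_rec : forall k, (1 <= k)%N ->
  x k.+1 - x k + (lam * k%:R `^ de) *: u k.+1 + (c / k%:R `^ p) *: x k
  = (1 - al / k%:R `^ q) *: (x k - x k.-1).

(* The weight [k `^ - theta] makes the Tikhonov source [k `^ (q - p)] summable
   in the critical case [p = q + 1]. *)
Lemma weighted_rates (theta : R) : 0 <= theta -> q + 1 < p + theta ->
  [/\ exists M : R, \forall k \near \oo, k%:R `^ (q + 1 + de - theta) * g k <= M,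
      exists M : R, \forall k \near \oo,
        k%:R `^ (q + 1 - theta) * `|x k - x k.-1| ^+ 2 <= M,
      bounded_sums (fun k => k%:R `^ (q + de - theta) * g k),
      bounded_sums (fun k => k%:R `^ (1 - theta) * `|x k - x k.-1| ^+ 2)
    & bounded_sums (fun k => k%:R `^ (q + 1 + 2 * de - theta) * `|u k| ^+ 2)].
Proof.
move=> th0 pth.
have [a [n [rho [rho_gt0 rho_le_q a_gt n_spec]]]] : exists a n rho : R,
    [/\ 0 < rho, rho <= q, q + 1 + de < a &
      [/\ q < 1, n = a * al & rho <= 1 - q] \/
      [/\ q = 1, a < al - 1 & n = a * (al - a - 1)]].
  (* For [q < 1] any [a] above [q + 1 + de] works, and [q (1 - q)] is below both [q] and [1 - q].
     For [q = 1], [a] is the midpoint of [2 + de] and [al - 1], which are in this order because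
     [de < al - 3]. *)
  case: al_case => [q1|[q1 de_lt]].
    exists (q + 2 + de), ((q + 2 + de) * al), (q * (1 - q)).
    split; [by rewrite mulr_gt0// subr_gt0|by rewrite ler_piMr ?gerBl ?ltW|lra|left].
    by split => //; rewrite ler_piMl// subr_ge0 ltW.
  pose a := (2 + de + (al - 1)) / 2.
  exists a, (a * (al - a - 1)), 1; split => //; [by rewrite q1|rewrite /a q1; lra|right].
  by split => //; rewrite /a; lra.
have hge := near_energy_ge Hdot p al_gt0 c_gt0 q_gt0 q_le1 lam_gt0 de_ge0 a_gt n_spec
  x z g_ge0.
have [Kg [kap [C [Kg0 kap0 C0 hdecr]]]] := near_energy_decr Hdot al_gt0 c_gt0 q_gt0
  q_le1 qp lam_gt0 de_ge0 rho_gt0 rho_le_q a_gt n_spec g_ge0 g_le g_diff x_rec.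
set E0 := energy _ _ _ _ _ _ _ _ _ _ _ _ in hge hdecr.
set K8 := 8 + 8 * a ^+ 2 / n in hge.
have K80 : 0 <= K8.
  have n0 : 0 < n.
    case: n_spec => [[_ -> _]|[_ h ->]]; rewrite mulr_gt0//; move: q_gt0 de_ge0 a_gt; lra.
  by rewrite addr_ge0// divr_ge0 ?(ltW n0)// mulr_ge0 ?sqr_ge0.
have hE1 : \forall k \near \oo, 0 <= E0 k.+1.
  by case: hge => N _ hN; exists N => // k /= /leqW/hN[].
pose A (k : nat) := k%:R `^ (- theta) * (Kg * (k%:R `^ (q + de) * g k.+1)
    + kap * (k%:R * dot (x k.+1 - x k) (x k.+1 - x k))
    + 2^-1 * lam ^+ 2 * (k%:R `^ (q + 1 + 2 * de) * dot (u k.+1) (u k.+1))).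
have lam2 : 0 < 2^-1 * lam ^+ 2 by rewrite mulr_gt0 ?exprn_gt0 ?invr_gt0.
have bE : bounded_sums (fun k : nat => C * k%:R `^ (-1 - rho)).
  exact: bounded_sumsZ (bounded_sums_powR rho_gt0).
(* The exponents are [- theta + (q - p)] and [- theta + (-1 - rho)], written as [-1 - r] with
   [r > 0]. *)
have bd : bounded_sums (fun k : nat =>
    C * (k%:R `^ (-1 - (p + theta - q - 1)) + k%:R `^ (-1 - (rho + theta)))).
  by apply: bounded_sumsZ => //; apply: bounded_sumsD; apply: bounded_sums_powR; lra.
have [[M hM] bA] : (exists M : R, \forall k \near \oo, k%:R `^ (- theta) * E0 k <= M)
    /\ bounded_sums A.
  apply: discrete_gronwall bE bd _; near=> k.
  have k2 : (2 <= k)%N by near: k; exact: nbhs_infty_ge.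
  have t1 : 1 <= k%:R :> R by rewrite ler1n ltnW.
  have t0 : 0 < k%:R :> R by rewrite (lt_le_trans _ t1).
  have [e0 _ _ _] : [/\ 0 <= E0 k, n * dot (x k - z) (x k - z) <= E0 k,
      lam * (k%:R `^ (q + 1 + de) * g k) <= E0 k
    & k%:R `^ (q + 1) * dot (x k - x k.-1) (x k - x k.-1) <= K8 * E0 k] by near: k.
  have e1 : 0 <= E0 k.+1 by near: k.
  have dec : E0 k.+1 + (Kg * (k%:R `^ (q + de) * g k.+1)
      + kap * (k%:R * dot (x k.+1 - x k) (x k.+1 - x k))
      + 2^-1 * lam ^+ 2 * (k%:R `^ (q + 1 + 2 * de) * dot (u k.+1) (u k.+1)))
    <= (1 + C * k%:R `^ (-1 - rho)) * E0 k + C * (k%:R `^ (q - p) + k%:R `^ (-1 - rho)).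
    by near: k.
  have g1 := g_ge0 (leqW k2).
  split.
  - by rewrite mulr_ge0 ?powR_ge0.
  - rewrite mulr_ge0 ?powR_ge0// !addr_ge0//.
    + by rewrite !mulr_ge0 ?powR_ge0// ltW.
    + by rewrite !mulr_ge0 ?(dot_ge0 Hdot)// ltW.
    + by rewrite mulr_ge0 ?(ltW lam2)// mulr_ge0 ?powR_ge0 ?(dot_ge0 Hdot).
  - by rewrite mulr_ge0 ?powR_ge0.
  - by rewrite mulr_ge0// addr_ge0 ?powR_ge0.
  have P0 : 0 < k%:R `^ (- theta) :> R by rewrite powR_gt0.
  have th0' : - theta <= 0 by rewrite oppr_le0.
  (* The weight [k ^ (- theta)] is nonincreasing, so [E0 k.+1] may carry the weight of its own
     index. *)
  have := ler_wpM2r e1 (powR_succ_le t0 th0'); rewrite natr1 => e2.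
  have := ler_wpM2l (ltW P0) dec.
  have -> : -1 - (p + theta - q - 1) = - theta + (q - p) by lra.
  have -> : -1 - (rho + theta) = - theta + (-1 - rho) by lra.
  rewrite !(powR_add (- theta) _ t0) /A; lra.
have mono (e1 : R) (k : nat) : (0 < k)%N -> k%:R `^ (e1 - theta) = k%:R `^ (- theta) * k%:R `^ e1 :> R.
  by move=> k0; rewrite addrC powR_add// ltr0n.
split.
- exists (lam^-1 * M); near=> k.
  have k0 : (0 < k)%N by near: k; exact: nbhs_infty_gt.
  have [_ _ e0 _] : [/\ 0 <= E0 k, n * dot (x k - z) (x k - z) <= E0 k,
      lam * (k%:R `^ (q + 1 + de) * g k) <= E0 k
    & k%:R `^ (q + 1) * dot (x k - x k.-1) (x k - x k.-1) <= K8 * E0 k] by near: k.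
  have em : k%:R `^ (- theta) * E0 k <= M by near: k.
  rewrite mono// -(ler_pM2l lam_gt0) mulVKf ?gt_eqF//; apply: le_trans em.
  by have := ler_wpM2l (powR_ge0 k%:R (- theta)) e0; lra.
- exists (K8 * M); near=> k.
  have k0 : (0 < k)%N by near: k; exact: nbhs_infty_gt.
  have [_ _ _ e0] : [/\ 0 <= E0 k, n * dot (x k - z) (x k - z) <= E0 k,
      lam * (k%:R `^ (q + 1 + de) * g k) <= E0 k
    & k%:R `^ (q + 1) * dot (x k - x k.-1) (x k - x k.-1) <= K8 * E0 k] by near: k.
  have em : k%:R `^ (- theta) * E0 k <= M by near: k.
  rewrite mono// Hdot; apply: (le_trans _ (ler_wpM2l K80 em)).
  by have := ler_wpM2l (powR_ge0 k%:R (- theta)) e0; lra.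
- apply: (bounded_sums_succ_powR Kg0 _ bA); near=> k.
  have k2 : (2 <= k)%N by near: k; exact: nbhs_infty_ge.
  split; first exact: (g_ge0 (leqW k2)).
  rewrite mono ?(ltnW k2)// /A -subr_ge0.
  have -> (P G X Y T : R) : P * (Kg * (T * G) + X + Y) - Kg * (P * T * G) = P * (X + Y) by ring.
  rewrite mulr_ge0 ?powR_ge0// addr_ge0//.
  + by rewrite !mulr_ge0 ?(dot_ge0 Hdot)// ltW.
  + by rewrite mulr_ge0 ?(ltW lam2)// mulr_ge0 ?powR_ge0 ?(dot_ge0 Hdot).
- apply: (bounded_sums_succ_powR (h := fun k => `|x k - x k.-1| ^+ 2) kap0 _ bA); near=> k.
  have k2 : (2 <= k)%N by near: k; exact: nbhs_infty_ge.
  split; first exact: sqr_ge0.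
  rewrite mono ?(ltnW k2)// /A -subr_ge0 powRr1// Hdot /=.
  have -> (P G X Y T : R) : P * (X + kap * (T * G) + Y) - kap * (P * T * G) = P * (X + Y) by ring.
  rewrite mulr_ge0 ?powR_ge0// addr_ge0//.
  + by rewrite !mulr_ge0 ?powR_ge0 ?(g_ge0 (leqW k2))// ltW.
  + by rewrite mulr_ge0 ?(ltW lam2)// mulr_ge0 ?powR_ge0 ?(dot_ge0 Hdot).
- apply: (bounded_sums_succ_powR (h := fun k => `|u k| ^+ 2) lam2 _ bA); near=> k.
  have k2 : (2 <= k)%N by near: k; exact: nbhs_infty_ge.
  split; first exact: sqr_ge0.
  rewrite mono ?(ltnW k2)// /A -subr_ge0 Hdot /=.
  have -> (P G X L T : R) : P * (X + L * (T * G)) - L * (P * T * G) = P * X by ring.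
  rewrite mulr_ge0 ?powR_ge0// addr_ge0//.
  + by rewrite !mulr_ge0 ?powR_ge0 ?(g_ge0 (leqW k2))// ltW.
  + by rewrite !mulr_ge0 ?(dot_ge0 Hdot)// ltW.
Unshelve. all: by end_near. Qed.

End Rates.

(** * The inertial proximal algorithm *)

Section Convergence.
Context {R : realType} {H : completeNormedModType R}.
Variable dot : {dot H for idfun}.
Hypothesis Hdot : induces_norm dot.
Variables (f : H -> \bar R).
Hypothesis f_proper : proper_efun f.
Hypothesis f_convex : convex_efun f.
Hypothesis f_lsc : lower_semicontinuous f.
Hypothesis f_argmin : argmin f !=set0.
Variables (alpha c q p lambda delta : R).
Hypotheses (alpha_gt0 : 0 < alpha) (c_gt0 : 0 < c).
Hypotheses (q_gt0 : 0 < q) (q_le1 : q <= 1) (qp : q + 1 <= p).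
Hypotheses (lambda_gt0 : 0 < lambda) (delta_ge0 : 0 <= delta).
Variables (x u : nat -> H).
Hypothesis x_rec : forall k : nat, (1 <= k)%N ->
  x k.+1 = prox (lambda_ lambda delta k) f
    (x k + alpha_ alpha q k *: (x k - x k.-1) - c_ c p k *: x k).
Hypothesis u_def : forall k : nat, (2 <= k)%N ->
  x k = alpha_ alpha q k.-1 *: (x k.-1 - x k.-2)
        - lambda_ lambda delta k.-1 *: u k + (1 - c_ c p k.-1) *: x k.-1.

(** Comparing [u_def] with the argument [y] of the proximal map identifies [u k] with
    [lambda^-1 (y - prox y)], the vector of [prox_subgradient]. *)
Lemma iterate_subgradient (k : nat) : (2 <= k)%N ->
  subdifferential dot f (x k) (u k).
Proof.
case: k => [|[|k]]// _; have k1 : (1 <= k.+1)%N by [].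
set y := x k.+1 + alpha_ alpha q k.+1 *: (x k.+1 - x k) - c_ c p k.+1 *: x k.+1.
have la0 : 0 < lambda_ lambda delta k.+1.
  by rewrite /lambda_ mulr_gt0// powR_gt0.
have xy : x k.+2 = prox (lambda_ lambda delta k.+1) f y by rewrite x_rec.
have -> : u k.+2 = (lambda_ lambda delta k.+1)^-1 *: (y - x k.+2).
  have -> : y - x k.+2 = lambda_ lambda delta k.+1 *: u k.+2.
    rewrite (u_def (k := k.+2))//= /y (scalerBl 1 (c_ c p k.+1)) scale1r; apply/eqP; rewrite subr_eq.
    move: (_ *: (x k.+1 - x k)) (_ *: u k.+2) (_ *: x k.+1) => A B C.
    by rewrite addrA (addrC B) subrK addrA (addrC (x _)).
  by rewrite scalerA mulVf ?gt_eqF// scale1r.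
rewrite xy; exact: prox_subgradient.
Qed.

Let g (k : nat) : R := fine (f (x k) - minval f)%E.

Lemma gap_EFin (k : nat) : f (x k) \is a fin_num ->
  0 <= g k /\ (f (x k) - minval f)%E = (g k)%:E.
Proof.
move=> fk; have mf := minval_fin_num f_proper f_argmin.
have -> : (f (x k) - minval f)%E = (g k)%:E by rewrite fineK// fin_numB fk.
by split=> //; apply: fine_ge0; rewrite sube_ge0 ?minval_le// orbC fk.
Qed.

Lemma iterate_fin_num (k : nat) : (2 <= k)%N -> f (x k) \is a fin_num.
Proof. by move=> /iterate_subgradient[]. Qed.

(** From index 2 on the iterates are proximal points and have finite values; [x 1] is arbitrary, so
    the series starting at 1 is conditional on [f (x 1)] being finite. *)
Lemma gap_series (e : R) : bounded_sums (fun k => k%:R `^ e * g k) ->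
  (\sum_(2 <= k <oo) (k%:R `^ e)%:E * (f (x k) - minval f) < +oo)%E /\
  ((f (x 1%N) < +oo)%E ->
   (\sum_(1 <= k <oo) (k%:R `^ e)%:E * (f (x k) - minval f) < +oo)%E).
Proof.
have gapM k : f (x k) \is a fin_num -> 0 <= k%:R `^ e * g k /\
    ((k%:R `^ e)%:E * (f (x k) - minval f))%E = (k%:R `^ e * g k)%:E.
  by move=> /gap_EFin[g0 ->]; rewrite mulr_ge0 ?powR_ge0.
move=> hs; split=> [|f1].
  by apply: bounded_sums_eseries hs => k /iterate_fin_num/gapM.
apply: bounded_sums_eseries hs => k; rewrite leq_eqVlt => /predU1P[<-|/iterate_fin_num/gapM//].
by apply: gapM; rewrite fin_numElt f1 andbT ltNye; case: f_proper.
Qed.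

(** Instance of [weighted_rates] with [z] a minimizer: the two inequalities on [g] are the
    subgradient inequality at [x k] tested at [z], and the one at [x k.+1] tested at [x k]. *)
Lemma algorithm_weighted_rates (theta : R) :
  q < 1 \/ q = 1 /\ delta < alpha - 3 -> 0 <= theta -> q + 1 < p + theta ->
  [/\ exists M : R, \forall k \near \oo, k%:R `^ (q + 1 + delta - theta) * g k <= M,
      exists M : R, \forall k \near \oo,
        k%:R `^ (q + 1 - theta) * `|x k - x k.-1| ^+ 2 <= M,
      bounded_sums (fun k => k%:R `^ (q + delta - theta) * g k),
      bounded_sums (fun k => k%:R `^ (1 - theta) * `|x k - x k.-1| ^+ 2)
    & bounded_sums (fun k => k%:R `^ (q + 1 + 2 * delta - theta) * `|u k| ^+ 2)].
Proof.
move=> cases; have [z zm] := f_argmin.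
have mz := minval_argmin zm; have zf := argmin_fin_num f_proper zm.
have gap k : (2 <= k)%N -> g k = fine (f (x k)) - fine (f z).
  by move=> /iterate_fin_num fk; rewrite /g mz fineB.
apply: (@weighted_rates R H dot Hdot alpha c q p lambda delta _ _ _ _ _ _ _ _ x u z g)
  => // k k1.
- by have [] := gap_EFin (iterate_fin_num k1).
- have [fk /(_ z)] := iterate_subgradient k1.
  rewrite gap// -(fineK fk) -(fineK zf) -EFinD lee_fin -(opprB (x k) z) dotNr (dotC _ (u k)).
  lra.
- have [fk /(_ (x k))] := iterate_subgradient (leqW k1).
  rewrite !gap ?(leqW k1)// -(fineK fk) -(fineK (iterate_fin_num k1)) -EFinD lee_fin.
  by rewrite -(opprB (x k.+1) (x k)) dotNr (dotC _ (u k.+1)); lra.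
- rewrite (u_def (k := k.+1))//= (scalerBl 1 (c_ c p k)) scale1r.
  rewrite -/(alpha_ alpha q k) -/(lambda_ lambda delta k) -/(c_ c p k).
  move: (_ *: (x k - x k.-1)) (_ *: u k.+1) (_ *: x k) => A B C.
  by rewrite (addrC (x k)) addrA addrK addrAC subrK subrK.
Qed.

End Convergence.

(** * Rates for the noncritical and the general range of [p] *)

Theorem theorem2p1 (R : realType) (H : completeNormedModType R)
    (dot : {dot H for idfun}) (Hdot : induces_norm dot)
    (f : H -> \bar R)
    (f_proper : proper_efun f) (f_convex : convex_efun f)
    (f_lsc : lower_semicontinuous f) (f_argmin : argmin f !=set0)
    (alpha c q p lambda delta : R)
    (alpha_gt0 : 0 < alpha) (c_gt0 : 0 < c)
    (q_gt0 : 0 < q) (q_le1 : q <= 1) (qp : q + 1 <= p)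
    (lambda_gt0 : 0 < lambda) (delta_ge0 : 0 <= delta)
    (x : nat -> H)
    (x_rec : forall k : nat, (1 <= k)%N ->
      x k.+1 = prox (lambda_ lambda delta k) f
                 (x k + alpha_ alpha q k *: (x k - x k.-1) - c_ c p k *: x k))
    (u : nat -> H)
    (u_def : forall k : nat, (2 <= k)%N ->
      x k = alpha_ alpha q k.-1 *: (x k.-1 - x k.-2)
            - lambda_ lambda delta k.-1 *: u k
            + (1 - c_ c p k.-1) *: x k.-1) :
  [/\ (forall k : nat, (2 <= k)%N -> subdifferential dot f (x k) (u k)),
      ([/\ 0 < alpha, 0 <= delta, 0 < q < 1, q + 1 < p <= 2
         & (p = 2 -> q * (1 - q) < c)]
       \/ [/\ 3 < alpha, 0 <= delta < alpha - 3, q = 1 & 2 < p]) ->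
      [/\ [/\ (fun k : nat => fine (f (x k) - minval f)%E)
                =O_\oo (fun k : nat => k%:R `^ (- q - delta - 1)),
              (fun k : nat => `|x k - x k.-1|)
                =O_\oo (fun k : nat => k%:R `^ (- ((q + 1) / 2)))
            & (fun k : nat => `|u k|)
                =o_\oo (fun k : nat => k%:R `^ (- ((q + 1) / 2) - delta))],
          (\sum_(2 <= k <oo)
             (k%:R `^ (q + delta))%:E * (f (x k) - minval f) < +oo)%E,
          ((f (x 1%N) < +oo)%E ->
           (\sum_(1 <= k <oo)
              (k%:R `^ (q + delta))%:E * (f (x k) - minval f) < +oo)%E),
          (\sum_(1 <= k <oo) (k%:R * `|x k - x k.-1| ^+ 2)%:E < +oo)%E
        & (\sum_(2 <= k <oo)
             (k%:R `^ (q + 2 * delta + 1) * `|u k| ^+ 2)%:E < +oo)%E]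
    & ([/\ 0 < alpha, 0 <= delta, 0 < q < 1 & q + 1 <= p]
       \/ [/\ 3 < alpha, 0 <= delta < alpha - 3, q = 1 & 2 <= p]) ->
      forall s : R, 1 / 2 < s < (q + 1) / 2 ->
      [/\ [/\ (fun k : nat => fine (f (x k) - minval f)%E)
                =o_\oo (fun k : nat => k%:R `^ (- (2 * s) - delta)),
              (fun k : nat => `|x k - x k.-1|)
                =o_\oo (fun k : nat => k%:R `^ (- s))
            & (fun k : nat => `|u k|)
                =o_\oo (fun k : nat => k%:R `^ (- s - delta))],
          (\sum_(2 <= k <oo)
             (k%:R `^ (2 * s + delta - 1))%:E * (f (x k) - minval f) < +oo)%E,
          ((f (x 1%N) < +oo)%E ->
           (\sum_(1 <= k <oo)
              (k%:R `^ (2 * s + delta - 1))%:E * (f (x k) - minval f)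
              < +oo)%E),
          (\sum_(1 <= k <oo)
             (k%:R `^ (2 * s - q) * `|x k - x k.-1| ^+ 2)%:E < +oo)%E
        & (\sum_(2 <= k <oo)
             (k%:R `^ (2 * s + 2 * delta) * `|u k| ^+ 2)%:E < +oo)%E]].
Proof.
have sub k : (2 <= k)%N -> subdifferential dot f (x k) (u k).
  exact: (iterate_subgradient Hdot f_proper f_convex f_lsc f_argmin lambda_gt0 x_rec u_def).
pose g k := fine (f (x k) - minval f)%E.
have g_ge0 k : (2 <= k)%N -> 0 <= g k.
  by move=> /sub[fk _]; have [] := gap_EFin f_proper f_argmin fk.
have rates := algorithm_weighted_rates Hdot f_proper f_convex f_lsc f_argmin alpha_gt0
  c_gt0 q_gt0 q_le1 qp lambda_gt0 delta_ge0 x_rec u_def.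
have series := gap_series Hdot f_proper f_convex f_lsc f_argmin lambda_gt0 x_rec u_def.
have bound (h : nat -> R) (e M : R) : (forall k, (2 <= k)%N -> 0 <= h k) ->
    (\forall k \near \oo, k%:R `^ e * h k <= M) ->
    \forall k \near \oo, 0 <= h k <= M * k%:R `^ (- e).
  move=> h0 hM; near=> k.
  have k2 : (2 <= k)%N by near: k; exact: nbhs_infty_ge.
  have k0 : 0 < k%:R :> R by rewrite ltr0n ltnW.
  rewrite h0// powRN ler_pdivlMr ?powR_gt0// mulrC; near: k; exact: hM.
have bound_sqr (e M : R) : (\forall k \near \oo, k%:R `^ (2 * e) * `|x k - x k.-1| ^+ 2 <= M) ->
    \forall k \near \oo, 0 <= `|x k - x k.-1| <= (`|M| + 1) * k%:R `^ (- e).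
  move=> hM; near=> k.
  have k0 : 0 < k%:R :> R by rewrite ltr0n; near: k; exact: nbhs_infty_gt.
  rewrite normr_ge0/=; apply: sqr_le_powR => //; near: k; exact: hM.
have nonneg_series (e : R) (v : nat -> H) (m : nat) :
    bounded_sums (fun k => k%:R `^ e * `|v k| ^+ 2) ->
    (\sum_(m <= k <oo) (k%:R `^ e * `|v k| ^+ 2)%:E < +oo)%E.
  by apply: bounded_sums_eseries => k _; rewrite mulr_ge0 ?powR_ge0 ?sqr_ge0.
split => //.
- move=> cases.
  (* Both cases have [p > q + 1], so the unweighted choice [theta = 0] is admissible. *)
  have [[Mg hg] [Mv hv] sg sv su] :
    [/\ exists M : R, \forall k \near \oo, k%:R `^ (q + 1 + delta - 0) * g k <= M,
      exists M : R, \forall k \near \oo,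
        k%:R `^ (q + 1 - 0) * `|x k - x k.-1| ^+ 2 <= M,
      bounded_sums (fun k => k%:R `^ (q + delta - 0) * g k),
      bounded_sums (fun k => k%:R `^ (1 - 0) * `|x k - x k.-1| ^+ 2)
    & bounded_sums (fun k => k%:R `^ (q + 1 + 2 * delta - 0) * `|u k| ^+ 2)].
    apply: rates => //; case: cases => [[_ _ /andP[_ ?] /andP[? _] _]|[_ /andP[_ ?] ? ?]]; lra.
  move: sg sv su; rewrite !subr0 => sg sv su.
  have [s2 s1] := series _ sg.
  split => //.
  + split.
    * have -> : - q - delta - 1 = - (q + 1 + delta - 0) by lra.
      exact: (bigO_powR (bound _ _ _ g_ge0 hg)).
    * apply: (bigO_powR (bound_sqr ((q + 1) / 2) Mv _)).
      by have -> : 2 * ((q + 1) / 2) = q + 1 - 0 by lra.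
    (* The [o] bound for [u] comes from its series alone. *)
    * have -> : - ((q + 1) / 2) - delta = - ((q + 1) / 2 + delta) by lra.
      apply: littleo_bounded_sums => [k|]; first exact: normr_ge0.
      by have -> : 2 * ((q + 1) / 2 + delta) = q + 1 + 2 * delta by lra.
  + apply: bounded_sums_eseries sv => k _.
    by rewrite powRr1// mulr_ge0 ?sqr_ge0.
  + apply: nonneg_series.
    by have -> : q + 2 * delta + 1 = q + 1 + 2 * delta by lra.
move=> cases s /andP[s_gt s_lt].
pose theta := q + 1 - 2 * s.
have th0 : 0 < theta by rewrite /theta; lra.
have al_case : q < 1 \/ q = 1 /\ delta < alpha - 3.
  by case: cases => [[_ _ /andP[_ ?] _]|[_ /andP[_ ?] ? _]]; [left|right].
have pth (r : R) : 0 < r -> q + 1 < p + r by move: qp; lra.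
have [_ _ sg sv su] := rates theta al_case (ltW th0) (pth _ th0).
have th20 : 0 < theta / 2 by rewrite divr_gt0.
(* Here [q + 1 - theta / 2 > q + 1 - theta = 2 s], so the [O] bounds decay strictly faster than the
   required powers. *)
have [[Mg hg] [Mv hv] _ _ _] := rates (theta / 2) al_case (ltW th20) (pth _ th20).
have e1 : 2 * s + delta - 1 = q + delta - theta by rewrite /theta; lra.
have e2 : 2 * s - q = 1 - theta by rewrite /theta; lra.
have e3 : 2 * s + 2 * delta = q + 1 + 2 * delta - theta by rewrite /theta; lra.
have [s2 s1] := series _ sg.
rewrite e1 e2 e3; split => //.
- split.
  + apply: littleo_powR (bound _ _ _ g_ge0 hg); rewrite /theta; lra.
  + apply: (littleo_powR (e' := - ((q + 1 - theta / 2) / 2)) (M := `|Mv| + 1)).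
      by rewrite /theta; lra.
    apply: bound_sqr.
    by have -> : 2 * ((q + 1 - theta / 2) / 2) = q + 1 - theta / 2 by lra.
  + have -> : - s - delta = - (s + delta) by lra.
    apply: littleo_bounded_sums => [k|]; first exact: normr_ge0.
    by have -> : 2 * (s + delta) = q + 1 + 2 * delta - theta by rewrite /theta; lra.
- exact: (nonneg_series _ (fun k => x k - x k.-1)).
- exact: nonneg_series.
Unshelve. all: by end_near. Qed.
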